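(* Let $L>0$, $\alpha\in(\tfrac12,1]$, and let $\gamma:[0,L]\to\mathbb{R}^n$ be an arc-length parameterized curve in $C^{1,\alpha}([0,L])$. Then $\gamma$ is strongly self-contracted if and only if there exist a parameterization $\tilde\gamma:[0,T]\to\mathbb{R}^n$ of $\gamma$ with $T<+\infty$ and a $C^1$ convex function $f:\mathbb{R}^n\to\mathbb{R}$ such that $\tilde\gamma'(t)=-\nabla f(\tilde\gamma(t))$ for all $t\in[0,T]$. Moreover, if $\gamma$ is strongly self-contracted and belongs to $C^3([0,L])$, then one can find a $C^1$ convex function $f:\mathbb{R}^n\to\mathbb{R}$ attaining its minimum at $\gamma(L)$ and a parameterization $\tilde\gamma:[0,+\infty)\to\mathbb{R}^n$ of $\gamma$ (that is, $T=+\infty$ in this case, with $\gamma(L)=\lim_{t\to+\infty}\tilde\gamma(t)$) such that $\tilde\gamma'(t)=-\nabla f(\tilde\gamma(t))$ for all $t\in[0,+\infty)$.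
   Context: Arc-length parameterized means $\|\gamma'(t)\|=1$ for all $t$ (Euclidean norm). $C^{1,\alpha}([0,L])$ means $\gamma$ is $C^1$ on $[0,L]$ with $\gamma'$ $\alpha$-Hölder continuous on $[0,L]$. A differentiable curve $\gamma:[0,L]\to\mathbb{R}^n$ is strongly self-contracted if for all $t,s\in[0,L]$ with $t<s$ and $\gamma'(t)\neq0$ one has $\langle\gamma'(t),\gamma(s)-\gamma(t)\rangle>0$. A parameterization of $\gamma$ on $[0,T]$, $T<+\infty$, is a curve $\tilde\gamma=\gamma\circ\theta^{-1}$ where $\theta:[0,L]\to[0,T]$ is an increasing homeomorphism; a parameterization on $[0,+\infty)$ (case $T=+\infty$) is a curve $\tilde\gamma=\gamma\circ\theta^{-1}$ where $\theta:[0,L)\to[0,+\infty)$ is an increasing homeomorphism, so that $\tilde\gamma(t)\to\gamma(L)$ as $t\to+\infty$. *)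

(* Defs.v *)
From HB Require Import structures.
From mathcomp Require Import all_boot all_order all_algebra.
From mathcomp Require Import all_classical all_reals all_analysis.

Set Implicit Arguments.
Unset Strict Implicit.
Unset Printing Implicit Defensive.

Import Order.TTheory GRing.Theory Num.Theory.
Import numFieldNormedType.Exports.

Local Open Scope classical_set_scope.
Local Open Scope ring_scope.

(* The library norm on 'rV[R]_n is the sup norm: it gives the right topology,
   but arc-length parameterization needs the Euclidean norm. *)
Definition dotv (R : realType) (n : nat) (u v : 'rV[R]_n) : R :=
  \sum_(i < n) u 0 i * v 0 i.

Definition enorm (R : realType) (n : nat) (u : 'rV[R]_n) : R :=
  Num.sqrt (dotv u u).

(* A curve on D is a total function R -> V of which only the values on D are
   used. The derivative at t is the limit of the difference quotients along D,
   hence one-sided when t is an endpoint of an interval D. *)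
Definition diff_quot (R : realType) (V : normedModType R) (g : R -> V)
    (t s : R) : V := (s - t)^-1 *: (g s - g t).

Definition derivable_within (R : realType) (V : normedModType R) (D : set R)
    (g : R -> V) (t : R) : Prop :=
  cvg (diff_quot g t s @[s --> within D t^']).

Definition derive_within (R : realType) (V : normedModType R) (D : set R)
    (g : R -> V) (t : R) : V :=
  lim (diff_quot g t s @[s --> within D t^']).

Fixpoint Ck_on (R : realType) (V : normedModType R) (D : set R) (k : nat)
    (g : R -> V) : Prop :=
  match k with
  | 0%N => {within D, continuous g}
  | k'.+1 => (forall t, D t -> derivable_within D g t) /\
             Ck_on D k' (derive_within D g)
  end.

Definition hoelder_on (R : realType) (n : nat) (D : set R) (alpha : R)
    (g : R -> 'rV[R]_n) : Prop :=
  exists C : R, forall s t, D s -> D t ->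
    enorm (g s - g t) <= C * `|s - t| `^ alpha.

Definition C1_hoelder_on (R : realType) (n : nat) (D : set R) (alpha : R)
    (g : R -> 'rV[R]_n) : Prop :=
  Ck_on D 1 g /\ hoelder_on D alpha (derive_within D g).

Definition arc_length_param (R : realType) (n : nat) (D : set R)
    (g : R -> 'rV[R]_n) : Prop :=
  forall t, D t -> enorm (derive_within D g t) = 1.

Definition strongly_self_contracted (R : realType) (n : nat) (D : set R)
    (g : R -> 'rV[R]_n) : Prop :=
  (forall t, D t -> derivable_within D g t) /\
  (forall t s, D t -> D s -> t < s -> derive_within D g t <> 0 ->
    0 < dotv (derive_within D g t) (g s - g t)).

(* theta : A -> B is an increasing homeomorphism with inverse eta. *)
Definition increasing_homeo (R : realType) (A B : set R) (theta eta : R -> R)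
    : Prop :=
  [/\ forall s, A s -> B (theta s) /\ eta (theta s) = s,
      forall t, B t -> A (eta t) /\ theta (eta t) = t,
      forall s s', A s -> A s' -> s < s' -> theta s < theta s',
      {within A, continuous theta} &
      {within B, continuous eta}].

Definition parameterization (R : realType) (n : nat) (A B : set R)
    (g gt : R -> 'rV[R]_n) : Prop :=
  exists theta eta : R -> R, increasing_homeo A B theta eta /\
    forall t, B t -> gt t = g (eta t).

Definition grad (R : realType) (n : nat) (f : 'rV[R]_n -> R) (x : 'rV[R]_n)
    : 'rV[R]_n := \row_(i < n) 'D_(delta_mx 0 i) f x.

Definition C1_convex (R : realType) (n : nat) (f : 'rV[R]_n -> R) : Prop :=
  [/\ forall x, differentiable f x, continuous (grad f) &
      convex_function setT f].

Definition gradient_curve (R : realType) (n : nat) (D : set R)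
    (f : 'rV[R]_n -> R) (g : R -> 'rV[R]_n) : Prop :=
  forall t, D t ->
    derivable_within D g t /\ derive_within D g t = - grad f (g t).

(* Main.v *)
Require Import Defs.
From HB Require Import structures.
From mathcomp Require Import all_boot all_order all_algebra.
From mathcomp Require Import all_classical all_reals all_analysis.
From mathcomp Require Import ring lra.

(* Put [F t = exp (k (L - t)) / k + c t], [h = - F'] and [G = - h gamma'], where
   [c = 0] for a finite time interval and [c = 1] for an infinite one ([h] then
   vanishes at [L]).  For [k] large the 1-jet [(F, G)] along [gamma] is convex
   with a quadratic margin,
     [F s - F t - <G t, gamma s - gamma t> >= m (s - t)^2].
   For [s < t] this is the convexity of the exponential together with unit
   speed.  For [t < s], Hoelder continuity with exponent at least 1/2 gives
   [<gamma' t, gamma s - gamma t> >= (s - t) - C (s - t)^2 / 2], which wins for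
   [s] near [t] if [k] is large against [C], while away from the diagonal the
   scalar product is bounded below by compactness.

   Since [G] is 1/2-Hoelder, the margin dominates [c' |G t - G s|^4], so
     [H a = sup_t (<gamma t, a> - F t + c' |a - G t|^4)]
   satisfies [H (G t) = <gamma t, G t> - F t].  As [H] is uniformly convex, its
   convex conjugate [f] is of class C1, and it extends the jet: [f = F] and
   [grad f = G] along [gamma].  The time change then solves the scalar equation
   [eta' = h eta], explicitly.

   Conversely, a convex [f] decreases strictly along its gradient curve, and
   [<- grad f x, y - x> >= f x - f y]; the unit tangent is a positive multiple
   of [- grad f]. *)

Set Implicit Arguments.
Unset Strict Implicit.
Unset Printing Implicit Defensive.

Import Order.TTheory GRing.Theory Num.Theory.
Import numFieldNormedType.Exports.

Local Open Scope classical_set_scope.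
Local Open Scope ring_scope.

(** * The Euclidean scalar product *)

Section Dot.
Context {R : realType} {n : nat}.
Implicit Types (u v w : 'rV[R]_n) (a : R).

Lemma dotvC u v : dotv u v = dotv v u.
Proof. by apply: eq_bigr => i _; rewrite mulrC. Qed.

Lemma dotvDl u v w : dotv (u + v) w = dotv u w + dotv v w.
Proof. by rewrite -big_split; apply: eq_bigr => i _; rewrite mxE mulrDl. Qed.

Lemma dotvZl a u v : dotv (a *: u) v = a * dotv u v.
Proof. by rewrite /dotv mulr_sumr; apply: eq_bigr => i _; rewrite mxE mulrA. Qed.

Lemma dotvNl u v : dotv (- u) v = - dotv u v.
Proof. by rewrite -scaleN1r dotvZl mulN1r. Qed.

Lemma dotvBl u v w : dotv (u - v) w = dotv u w - dotv v w.
Proof. by rewrite dotvDl dotvNl. Qed.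

Lemma dotv0l u : dotv 0 u = 0.
Proof. by rewrite -(scale0r 0) dotvZl mul0r. Qed.

Lemma dotvDr u v w : dotv u (v + w) = dotv u v + dotv u w.
Proof. by rewrite dotvC dotvDl !(dotvC u). Qed.

Lemma dotvZr a u v : dotv u (a *: v) = a * dotv u v.
Proof. by rewrite dotvC dotvZl dotvC. Qed.

Lemma dotvNr u v : dotv u (- v) = - dotv u v.
Proof. by rewrite dotvC dotvNl dotvC. Qed.

Lemma dotvBr u v w : dotv u (v - w) = dotv u v - dotv u w.
Proof. by rewrite dotvDr dotvNr. Qed.

Lemma dotv0r u : dotv u 0 = 0.
Proof. by rewrite dotvC dotv0l. Qed.

Lemma dotv_ge0 u : 0 <= dotv u u.
Proof. by apply: sumr_ge0 => i _; rewrite -expr2 sqr_ge0. Qed.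

Lemma dotvBB u v : dotv (u - v) (u - v) = dotv u u - 2 * dotv u v + dotv v v.
Proof. by rewrite !(dotvBl, dotvBr) (dotvC v); ring. Qed.

Lemma dotv_eq0 u : dotv u u = 0 -> u = 0.
Proof.
move=> /eqP; rewrite psumr_eq0 => [/allP u0|i _]; last by rewrite -expr2 sqr_ge0.
apply/rowP => i; rewrite mxE; apply/eqP.
by have := u0 i (mem_index_enum i); rewrite mulf_eq0 orbb.
Qed.

Lemma enorm_eq1 u : enorm u = 1 -> dotv u u = 1.
Proof. by move=> u1; rewrite -(sqr_sqrtr (dotv_ge0 u)) -/(enorm u) u1 expr1n. Qed.

(** Expanding [|<v, v> u - <u, v> v|^2 >= 0] gives the inequality multiplied by [<v, v>]. *)
Lemma dotv_CS u v : dotv u v ^+ 2 <= dotv u u * dotv v v.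
Proof.
have [v0|v0] := eqVneq (dotv v v) 0.
  by rewrite (dotv_eq0 v0) !dotv0r expr0n mulr0.
have : 0 <= dotv v v * (dotv u u * dotv v v - dotv u v ^+ 2).
  have := dotv_ge0 (dotv v v *: u - dotv u v *: v).
  rewrite !(dotvBl, dotvBr, dotvZl, dotvZr) (dotvC v u); nra.
by rewrite pmulr_rge0 ?subr_ge0// lt_def v0 dotv_ge0.
Qed.

Lemma dotv_young u v : 2 * `|dotv u v| <= dotv u u + dotv v v.
Proof.
have := dotv_ge0 (u - v); have := dotv_ge0 (u + v).
rewrite !(dotvBl, dotvBr, dotvDl, dotvDr) (dotvC v u).
by case: (ger0P (dotv u v)) => _; lra.
Qed.

(** [|u|] is the sup norm, which carries the topology; it is attained at an entry whose square is
    one summand of [dotv u u]. Together with [dotv_le_norm] this compares it with the Euclidean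
    norm. *)
Lemma norm_le_dotv u : `|u| ^+ 2 <= dotv u u.
Proof.
have [->|u0] := eqVneq u 0; first by rewrite normr0 expr0n dotv0l.
have [[i j] ->] : exists ij, `|u| = `|u ij.1 ij.2|.
  by apply: mx_norm_neq0; move: u0; rewrite -normr_eq0.
rewrite real_normK ?num_real// /dotv (bigD1 j)//= (ord1 i) expr2 lerDl.
by apply: sumr_ge0 => k _; rewrite -expr2 sqr_ge0.
Qed.

Lemma coord_le_norm u i : `|u 0 i| <= `|u|.
Proof.
rewrite [leRHS]mx_normrE.
exact: (le_bigmax _ (fun ij => `|u ij.1 ij.2|) (0, i)).
Qed.

Lemma dotv_le_norm u v : `|dotv u v| <= n%:R * (`|u| * `|v|).
Proof.
rewrite (le_trans (ler_norm_sum _ _ _))//.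
rewrite [leRHS](_ : _ = \sum_(i < n) `|u| * `|v|).
  by apply: ler_sum => i _; rewrite normrM ler_pM// coord_le_norm.
by rewrite sumr_const card_ord mulr_natl.
Qed.

Lemma dotv_cvg (T : Type) (F : set_system T) {FF : Filter F}
    (f g : T -> 'rV[R]_n) u v :
  f @ F --> u -> g @ F --> v -> dotv (f x) (g x) @[x --> F] --> dotv u v.
Proof.
move=> fu gv; apply: cvg_big => [|i _]; first exact: add_continuous.
have c := @coord_continuous R 1 n 0 i.
by apply: cvgM; [exact: (continuous_cvg _ (c u) fu)|exact: (continuous_cvg _ (c v) gv)].
Qed.

Lemma dotv_cvgr (T : Type) (F : set_system T) {FF : Filter F} u
    (f : T -> 'rV[R]_n) v :
  f @ F --> v -> dotv u (f x) @[x --> F] --> dotv u v.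
Proof. by move=> fv; apply: (dotv_cvg (f := cst u)) => //; exact: cvg_cst. Qed.

End Dot.

(** * Subgradients and convex functions of class C1 *)

Section Subgradient.
Context {R : realType} {n : nat}.
Implicit Types (f : 'rV[R]_n -> R) (g : 'rV[R]_n -> 'rV[R]_n).

Definition subgradient f g :=
  forall x y : 'rV[R]_n, f x + dotv (g x) (y - x) <= f y.

Lemma dotv_continuous (u : 'rV[R]_n) : continuous (dotv u).
Proof. by move=> v; exact: (@dotv_cvg _ _ _ (nbhs v) _ (cst u) id u v (cvg_cst _) cvg_id). Qed.

Lemma dotv_is_linear (u : 'rV[R]_n) : linear (dotv u : 'rV[R]_n -> R).
Proof. by move=> a v w; rewrite dotvDr dotvZr. Qed.

HB.instance Definition _ (u : 'rV[R]_n) :=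
  GRing.isLinear.Build R 'rV[R]_n R _ (dotv u) (dotv_is_linear u).

(** The inequalities at [x] and at [x + h] squeeze the remainder, [0 <= f (x + h) - f x - <g x, h>
    <= <g (x + h) - g x, h>], and continuity of [g] makes the right side [o(h)]. *)
Lemma subgradient_diff f g x : subgradient f g -> continuous g ->
  differentiable f x /\ 'd f x = dotv (g x) :> ('rV[R]_n -> R).
Proof.
move=> fg cg.
have E : f \o shift x = cst (f x) + (dotv (g x) : 'rV[R]_n -> R) +o_ 0 id.
  apply/eqaddoP => e e0; near=> h.
  rewrite !fctE /=.
  have h1 := fg x (h + x); have h2 := fg (h + x) x.
  move: h1 h2; rewrite addrK opprD addrA addrAC subrr sub0r dotvNr => h1 h2.
  have h3 := dotv_le_norm (g (h + x) - g x) h.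
  have : n%:R * `|g (h + x) - g x| <= e.
    (* [n.+1] in place of [n] keeps the divisor nonzero in dimension 0. *)
    rewrite distrC (@le_trans _ _ (n.+1%:R * `|g x - g (h + x)|))//.
      by rewrite ler_wpM2r// ler_nat.
    rewrite mulrC -ler_pdivlMr ?ltr0Sn//.
    near: h.
    have : g (h + x) @[h --> 0] --> g x.
      have := cvg_comp_shift x (0 : 'rV[R]_n) g; rewrite add0r => E.
      by rewrite [X in X --> _]E; exact: cg.
    by move/cvgrPdist_le; apply; rewrite divr_gt0// ltr0Sn.
  move=> h4.
  have {}h3 : `|dotv (g (h + x) - g x) h| <= e * `|h|.
    by apply: (le_trans h3); rewrite mulrA ler_wpM2r.
  apply: le_trans h3; rewrite ger0_norm; last lra.
  by apply: le_trans (ler_norm _); rewrite dotvBl; lra.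
have D := @diff_unique _ _ _ _ (dotv (g x)) x (dotv_continuous (u := _)) E.
split=> //; apply/diff_locallyP; rewrite D; split=> //; exact: dotv_continuous.
Unshelve. all: by end_near. Qed.

Lemma dotv_deltar (u : 'rV[R]_n) i : dotv u (delta_mx 0 i) = u 0 i.
Proof.
rewrite /dotv (bigD1 i)//= mxE !eqxx mulr1 big1 ?addr0// => j ji.
by rewrite mxE (negbTE ji) andbF mulr0.
Qed.

Lemma subgradient_grad f g : subgradient f g -> continuous g -> grad f = g.
Proof.
move=> fg cg; apply/funext => x; apply/rowP => i; rewrite mxE.
have [df dE] := subgradient_diff x fg cg.
by rewrite deriveE// dE dotv_deltar.
Qed.

Lemma subgradient_C1_convex f g :
  subgradient f g -> continuous g -> C1_convex f.
Proof.
move=> fg cg; split.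
- by move=> x; have [] := subgradient_diff x fg cg.
- by rewrite (subgradient_grad fg cg).
- move=> t x y _ _; rewrite convRE.
  set z := conv t x y.
  have zE : z = t%:num *: x + (1 - t%:num) *: y by [].
  have hx := fg z x; have hy := fg z y.
  have t0 : 0 <= t%:num by [].
  have t1 : t%:num <= 1 by [].
  (* Convexity comes from averaging the subgradient inequalities at [z]: the linear terms cancel
     because [z] is the barycentre. *)
  have : t%:num * dotv (g z) (x - z) + (1 - t%:num) * dotv (g z) (y - z) = 0.
    rewrite -!dotvZr -dotvDr.
    suff -> : t%:num *: (x - z) + (1 - t%:num) *: (y - z) = 0 by rewrite dotv0r.
    by rewrite !scalerBr addrACA -zE -opprD -scalerDl addrCA subrr addr0 scale1r subrr.
  rewrite -[unstable.onem _]/(1 - t%:num) => h.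
  have : t%:num * (f z + dotv (g z) (x - z)) <= t%:num * f x by rewrite ler_wpM2l.
  have : (1 - t%:num) * (f z + dotv (g z) (y - z)) <= (1 - t%:num) * f y.
    by rewrite ler_wpM2l// subr_ge0.
  lra.
Qed.

Lemma deriveE_grad f x v : differentiable f x -> 'D_v f x = dotv (grad f x) v.
Proof.
move=> df; rewrite deriveE// {1}(row_sum_delta v) linear_sum.
by apply: eq_bigr => i _; rewrite linearZ /= mxE deriveE// mulrC.
Qed.

Lemma C1_convex_subgradient f : C1_convex f -> subgradient f (grad f).
Proof.
move=> [df _ cf] x y.
rewrite -deriveE_grad// addrC -lerBrDr.
have dv : derivable f x (y - x) by exact: diff_derivable.
(* Only [h > 0] makes [h y + (1 - h) x] a convex combination, so the derivative is read as a limit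
   from the right. *)
rewrite /derive (cvg_at_rightE _ _ dv).
apply: limr_le.
  apply/cvg_ex; exists ('D_(y - x) f x); apply: cvg_trans dv; apply: cvg_fmap2 => A.
  rewrite /at_right /dnbhs /within /=; apply: filterS => h hA h0; apply: hA.
  by rewrite gt_eqF.
near=> h.
have h0 : 0 < h by [].
have h1 : h <= 1 by near: h; exact: nbhs_right_le.
have := cf (Itv01 (ltW h0) h1) y x (mem_set I) (mem_set I).
rewrite convRE /= -[unstable.onem _]/(1 - h).
have -> : conv (Itv01 (ltW h0) h1) (y : convex_lmodType _) x = h *: (y - x) + x.
  rewrite -[LHS]/(h *: y + (1 - h) *: x) scalerBr scalerBl scale1r.
  by rewrite addrCA addrC addrAC.
move=> h2; rewrite -[_ *: _]/(_ * _) mulrC ler_pdivrMr// /=; lra.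
Unshelve. all: by end_near. Qed.
End Subgradient.

(** * Convex C1 extension of a 1-jet *)

(** Uniform convexity of the fourth power of the Euclidean norm. With [a], [b], [d] as in the proof
    it amounts to [4 d^2 <= (a + b)^2 <= 2 (a^2 + b^2)]; the first bound is
    [|u - v|^2 |u + v|^2 >= 0]. *)
Lemma dotv_mid {R : realType} {n : nat} (u v : 'rV[R]_n) :
  dotv (2^-1 *: (u + v)) (2^-1 *: (u + v)) ^+ 2 <=
    (dotv u u ^+ 2 + dotv v v ^+ 2) / 2 - dotv (u - v) (u - v) ^+ 2 / 16.
Proof.
have := dotv_ge0 (u + v); have := dotv_ge0 (u - v).
rewrite !dotvZl !dotvZr !(dotvBl, dotvBr, dotvDl, dotvDr) (dotvC v u).
set a := dotv u u; set b := dotv v v; set d := dotv u v => h1 h2.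
have := sqr_ge0 (a - b).
have : 0 <= (a - d - (d - b)) * (a + d + (d + b)) by exact: mulr_ge0.
nra.
Qed.

Section Extension.
Context {R : realType} {n : nat} {T : Type}.
Context (A : set T) (x g : T -> 'rV[R]_n) (f : T -> R) (c M : R).
Context (A0 : A !=set0).
Context (c0 : 0 < c).
Context (xM : forall t, A t -> dotv (x t) (x t) <= M).
Context (gM : forall t, A t -> dotv (g t) (g t) <= M).
Context (fM : forall t, A t -> `|f t| <= M).
Context (gap : forall s t, A s -> A t ->
  c * dotv (g t - g s) (g t - g s) ^+ 2 <= f s - f t - dotv (g t) (x s - x t)).

(** By Fenchel's inequality [<x t, a> - f t] bounds from below the conjugate of any function with
    value [f t] at [x t]. The quartic term adds uniform convexity and vanishes at [a = g t].
    [jet_conj] is then the [H] of the overview, and [jet_ext] its conjugate. *)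
Definition lower_jet t a :=
  dotv (x t) a - f t + c * dotv (a - g t) (a - g t) ^+ 2.

Definition jet_conj a := sup [set lower_jet t a | t in A].

Definition jet_ext y := sup [set dotv y a - jet_conj a | a in setT].

Lemma lower_jet_le_conj t a : A t -> lower_jet t a <= jet_conj a.
Proof.
move=> At; apply: ub_le_sup; last by exists t.
exists ((M + dotv a a) / 2 + M + c * (2 * M + 2 * dotv a a) ^+ 2) => _ [s As <-].
rewrite /lower_jet lerD//.
  have := dotv_young (x s) a; have := ler_norm (dotv (x s) a).
  by have := ler_norm (- f s); rewrite normrN; have := fM As; have := xM As; lra.
rewrite ler_wpM2l ?(ltW c0)// ler_pXn2r ?nnegrE ?dotv_ge0//.
- have := dotv_ge0 (a + g s); have := gM As.
  by rewrite !(dotvBl, dotvBr, dotvDl, dotvDr) (dotvC (g s) a); lra.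
- by have := dotv_ge0 a; have := dotv_ge0 (x s); have := xM As; lra.
Qed.

Lemma jet_conj_le a B : (forall t, A t -> lower_jet t a <= B) -> jet_conj a <= B.
Proof.
move=> AB; apply: ge_sup; first by have [t At] := A0; exists (lower_jet t a), t.
by move=> _ [t At <-]; exact: AB.
Qed.

(** All the functions [lower_jet t] have the same modulus of uniform convexity, so it passes to
    their supremum. *)
Lemma jet_conj_mid a b : jet_conj (2^-1 *: (a + b)) <=
  (jet_conj a + jet_conj b) / 2 - c / 16 * dotv (a - b) (a - b) ^+ 2.
Proof.
apply: jet_conj_le => t At.
have := lower_jet_le_conj a At; have := lower_jet_le_conj b At.
have := dotv_mid (a - g t) (b - g t).
have -> : a - g t - (b - g t) = a - b by rewrite opprB addrA subrK.
have -> : 2^-1 *: (a - g t + (b - g t)) = 2^-1 *: (a + b) - g t.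
  by apply/rowP => i; rewrite !mxE; lra.
rewrite /lower_jet dotvZr dotvDr -(ler_pM2l c0); lra.
Qed.

Lemma jet_ext_ge y a : dotv y a - jet_conj a <= jet_ext y.
Proof.
apply: ub_le_sup; last by exists a.
have [t At] := A0.
(* A single index [t] bounds the supremum, since [jet_conj b >= lower_jet t b]. With
   [q = |b - g t|^2], Young's inequality bounds [<y - x t, b - g t>] by [(|y - x t|^2 + q) / 2], and
   the quartic term absorbs [q / 2] up to [1 / (16 c)]. *)
exists (dotv y (g t) + dotv (y - x t) (y - x t) / 2 +
  `|f t - dotv (x t) (g t)| + (16 * c)^-1) => _ [b _ <-].
have := lower_jet_le_conj b At.
have := dotv_young (y - x t) (b - g t); have := ler_norm (dotv (y - x t) (b - g t)).
have := ler_norm (f t - dotv (x t) (g t)).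
have : dotv (b - g t) (b - g t) / 2 <= c * dotv (b - g t) (b - g t) ^+ 2 + (16 * c)^-1.
  have := sqr_ge0 (c * 4 * dotv (b - g t) (b - g t) - 1).
  set q := dotv _ _ => h.
  rewrite -(ler_pM2l (_ : 0 < 16 * c)) ?mulr_gt0// mulrDr mulfV ?mulf_neq0 ?gt_eqF//.
  nra.
rewrite /lower_jet; set q := dotv (b - g t) (b - g t); set p := dotv (y - x t) (y - x t).
rewrite !(dotvBl, dotvBr); set e := (16 * c)^-1; lra.
Qed.

Lemma jet_ext_le y B : (forall a, dotv y a - jet_conj a <= B) -> jet_ext y <= B.
Proof.
move=> AB; apply: ge_sup; first by exists (dotv y 0 - jet_conj 0), 0.
by move=> _ [a _ <-].
Qed.

(** Test both suprema at the midpoint of [a] and [b] and use uniform convexity there. For [y = z] it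
    makes near maximisers cluster; for [y <> z] it gives continuity of the gradient. *)
Lemma near_max_dist y z a b d e :
  jet_ext y - d <= dotv y a - jet_conj a ->
  jet_ext z - e <= dotv z b - jet_conj b ->
  c / 8 * dotv (a - b) (a - b) ^+ 2 <= d + e + dotv (y - z) (a - b) / 2.
Proof.
have := jet_conj_mid a b.
have := jet_ext_ge y (2^-1 *: (a + b)); have := jet_ext_ge z (2^-1 *: (a + b)).
rewrite !dotvZr !dotvDr.
set q := dotv (a - b) (a - b); rewrite !(dotvBl, dotvBr); lra.
Qed.

Lemma near_maxP y e : 0 < e -> exists a, jet_ext y - e <= dotv y a - jet_conj a.
Proof.
move=> e0; have [|_ [a _ <-] h] := @sup_adherent _ [set dotv y a - jet_conj a | a in setT] e e0.
  split; first by exists (dotv y 0 - jet_conj 0), 0.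
  by exists (jet_ext y) => _ [a _ <-]; exact: jet_ext_ge.
by exists a; exact: ltW.
Qed.

(** A chosen maximiser of [<y, a> - jet_conj a] up to [1 / (k + 1)]. These sequences are Cauchy, and
    their limit [jet_grad y] serves as the maximiser, that is, as the gradient of the conjugate. *)
Definition near_max y k : 'rV[R]_n := sval (cid (near_maxP y (@harmonic_gt0 R k))).

Lemma near_max_spec y k :
  jet_ext y - harmonic k <= dotv y (near_max y k) - jet_conj (near_max y k).
Proof. exact: (svalP (cid (near_maxP y (@harmonic_gt0 R k)))). Qed.

Lemma near_max_cvg y : cvgn (near_max y).
Proof.
apply/cauchy_cvgP/cauchy_ballP => e e0.
(* Two near maximisers at distance at least [e] would give
   [c / 8 * e^4 <= 2 * (c / 16) * (e / 2)^4], which is absurd. *)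
have : \forall k \near \oo, harmonic k <= c / 16 * (e / 2) ^+ 4 :> R.
  have p : 0 < c / 16 * (e / 2) ^+ 4 by rewrite mulr_gt0 ?exprn_gt0 ?divr_gt0.
  by have /cvgr_le := @cvg_harmonic R; exact.
move=> [K _ hK].
pose S := [set near_max y k | k in [set k | (K <= k)%N]].
exists (S, S).
  by split; exists K => // k Kk; exists k.
move=> [_ _] [/= [k Kk <-] [l Kl <-]].
rewrite -ball_normE /=.
have := near_max_dist (near_max_spec y k) (near_max_spec y l).
rewrite subrr dotv0l mul0r addr0 => h.
have hk := hK k Kk; have hl := hK l Kl.
have hn := norm_le_dotv (near_max y k - near_max y l).
rewrite ltNge; apply/negP => en.
have : (`|near_max y k - near_max y l| ^+ 2) ^+ 2 <=
    dotv (near_max y k - near_max y l) (near_max y k - near_max y l) ^+ 2.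
  by rewrite ler_pXn2r ?nnegrE ?sqr_ge0 ?dotv_ge0.
have : e ^+ 4 <= `|near_max y k - near_max y l| ^+ 4.
  by rewrite ler_pXn2r ?nnegrE ?(ltW e0).
have : 0 < c * e ^+ 4 by rewrite mulr_gt0 ?exprn_gt0.
rewrite -exprM => h1 h2 h3.
have h4 := le_trans h2 h3.
move: h hk hl; rewrite expr_div_n; set D := dotv _ _ ^+ 2 in h3 h4 *.
have : c * e ^+ 4 <= c * D by rewrite ler_pM2l.
lra.
Qed.

Definition jet_grad y : 'rV[R]_n := limn (near_max y).

Lemma jet_grad_dist y z b e :
  jet_ext z - e <= dotv z b - jet_conj b ->
  c / 8 * dotv (jet_grad y - b) (jet_grad y - b) ^+ 2 <=
    e + dotv (y - z) (jet_grad y - b) / 2.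
Proof.
move=> h.
have d1 : near_max y k - b @[k --> \oo] --> jet_grad y - b.
  by apply: cvgB; [exact: near_max_cvg|exact: cvg_cst].
have d2 := dotv_cvg (FF := @filter_filter _ _ eventually_filter) d1 d1.
have d3 := dotv_cvgr (FF := @filter_filter _ _ eventually_filter) (u := y - z) d1.
apply: (@ler_cvg_to nat \oo _ R
  (fun k => c / 8 * dotv (near_max y k - b) (near_max y k - b) ^+ 2)
  (fun k => harmonic k + (e + dotv (y - z) (near_max y k - b) / 2))).
- by apply: cvgM; [exact: cvg_cst|exact: (cvg_comp _ _ d2 (@exprn_continuous R 2 _))].
- rewrite -[e + dotv _ (jet_grad y - b) / 2]add0r; apply: cvgD; first exact: cvg_harmonic.
  by apply: cvgD; [exact: cvg_cst|apply: cvgM => //; exact: cvg_cst].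
- by apply: nearW => k; rewrite addrA; exact: near_max_dist (near_max_spec _ _) h.
Qed.

Lemma jet_grad_dist2 y z :
  c / 8 * dotv (jet_grad y - jet_grad z) (jet_grad y - jet_grad z) ^+ 2 <=
    dotv (y - z) (jet_grad y - jet_grad z) / 2.
Proof.
have d1 : jet_grad y - near_max z k @[k --> \oo] --> jet_grad y - jet_grad z.
  by apply: cvgB; [exact: cvg_cst|exact: near_max_cvg].
have d2 := dotv_cvg (FF := @filter_filter _ _ eventually_filter) d1 d1.
have d3 := dotv_cvgr (FF := @filter_filter _ _ eventually_filter) (u := y - z) d1.
apply: (@ler_cvg_to nat \oo _ R
  (fun k => c / 8 * dotv (jet_grad y - near_max z k) (jet_grad y - near_max z k) ^+ 2)
  (fun k => harmonic k + dotv (y - z) (jet_grad y - near_max z k) / 2)).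
- by apply: cvgM; [exact: cvg_cst|exact: (cvg_comp _ _ d2 (@exprn_continuous R 2 _))].
- rewrite -[dotv _ (_ - jet_grad z) / 2]add0r; apply: cvgD; first exact: cvg_harmonic.
  by apply: cvgM => //; exact: cvg_cst.
- by apply: nearW => k; exact: jet_grad_dist (near_max_spec _ _).
Qed.

(** [jet_grad_dist2] and Cauchy-Schwarz give [c / 4 * |v|^4 <= |y - z| |v|] for the difference [v]
    of the gradients, so [jet_grad] is Hoelder continuous with exponent 1/3. *)
Lemma jet_grad_continuous : continuous jet_grad.
Proof.
move=> y; apply/(@cvgrPdist_lt _ _ _ (nbhs y)) => e e0.
near=> z.
have := jet_grad_dist2 y z; set v := jet_grad y - jet_grad z => h.
rewrite ltNge; apply/negP => ev.
have nv := norm_le_dotv v.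
have e2 : e ^+ 2 <= dotv v v by rewrite (le_trans _ nv)// ler_pXn2r ?nnegrE ?(ltW e0).
have q0 : 0 < dotv v v by rewrite (lt_le_trans _ e2)// exprn_gt0.
have cs := dotv_CS (y - z) v.
have : (c / 4) ^+ 2 * (e ^+ 2) ^+ 3 <= dotv (y - z) (y - z).
  rewrite (@le_trans _ _ ((c / 4) ^+ 2 * dotv v v ^+ 3))//.
    by rewrite ler_wpM2l ?sqr_ge0// ler_pXn2r ?nnegrE ?sqr_ge0 ?(ltW q0).
  rewrite -(ler_pM2r q0); apply: le_trans cs.
  have -> : (c / 4) ^+ 2 * dotv v v ^+ 3 * dotv v v = (c / 4 * dotv v v ^+ 2) ^+ 2 by ring.
  have p : 0 <= c / 8 * dotv v v ^+ 2 by rewrite mulr_ge0 ?sqr_ge0 ?divr_ge0 ?(ltW c0).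
  by rewrite ler_pXn2r ?nnegrE//; lra.
apply/negP; rewrite -ltNge.
have := dotv_le_norm (y - z) (y - z); rewrite ger0_norm ?dotv_ge0// => /le_lt_trans; apply.
have y1 : `|y - z| < 1.
  by near: z; exact: (@cvgr_dist_lt _ _ _ (nbhs y) _ id y cvg_id).
have y2 : `|y - z| < ((c / 4) ^+ 2 * (e ^+ 2) ^+ 3) / n.+1%:R.
  near: z; apply: (@cvgr_dist_lt _ _ _ (nbhs y) _ id y cvg_id).
  by rewrite divr_gt0 ?mulr_gt0 ?exprn_gt0 ?divr_gt0.
move: y2; rewrite ltr_pdivlMr ?ltr0Sn// mulrC; apply: le_lt_trans.
have : `|y - z| * `|y - z| <= `|y - z| by rewrite ler_piMr// ltW.
have : 0 <= n%:R * `|y - z| by rewrite mulr_ge0.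
rewrite -[n.+1%:R]natr1 => h1 h2.
have := ler_wpM2l (ler0n R n) h2; have := normr_ge0 (y - z); lra.
Unshelve. all: by end_near. Qed.

(** A near maximiser at [y] is also a competitor in the supremum at [z]; then pass to the limit. *)
Lemma jet_ext_subgradient : subgradient jet_ext jet_grad.
Proof.
move=> y z.
have d3 := dotv_cvgr (FF := @filter_filter _ _ eventually_filter) (u := z - y) (@near_max_cvg y).
rewrite -lerBrDl.
apply: (@ler_cvg_to nat \oo _ R (fun k => dotv (z - y) (near_max y k) - harmonic k)
  (fun k => jet_ext z - jet_ext y)).
- rewrite dotvC -[dotv _ _]subr0; apply: cvgB => //; exact: cvg_harmonic.
- exact: cvg_cst.
- apply: nearW => k.
  have := near_max_spec y k; have := jet_ext_ge z (near_max y k).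
  by rewrite dotvBl; lra.
Qed.

(** The upper bound is [jet_conj a >= <x t, a> - f t]. The lower bound tests [a = g t], where [gap]
    says exactly that no [lower_jet s] exceeds [<x t, g t> - f t]. *)
Lemma jet_ext_val t : A t -> jet_ext (x t) = f t.
Proof.
move=> At; apply/eqP; rewrite eq_le; apply/andP; split.
  apply: jet_ext_le => a; have := lower_jet_le_conj a At; rewrite /lower_jet.
  have : 0 <= c * dotv (a - g t) (a - g t) ^+ 2 by rewrite mulr_ge0 ?sqr_ge0 ?ltW.
  lra.
apply: le_trans (jet_ext_ge _ (g t)).
suff : jet_conj (g t) <= dotv (x t) (g t) - f t by lra.
apply: jet_conj_le => s As; have := gap As At.
rewrite /lower_jet; set q := dotv _ _ ^+ 2; rewrite !(dotvBl, dotvBr).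
rewrite (dotvC (g t)) (dotvC (g t)); lra.
Qed.

(** By [gap], [g t] is an exact maximiser at [x t], so [jet_grad_dist] with [e = 0] puts it at
    distance 0 from [jet_grad (x t)]. *)
Lemma jet_ext_grad t : A t -> jet_grad (x t) = g t.
Proof.
move=> At.
have : jet_ext (x t) - 0 <= dotv (x t) (g t) - jet_conj (g t).
  rewrite jet_ext_val// subr0.
  suff : jet_conj (g t) <= dotv (x t) (g t) - f t by lra.
  apply: jet_conj_le => s As; have := gap As At.
  rewrite /lower_jet; set q := dotv _ _ ^+ 2; rewrite !(dotvBl, dotvBr).
  rewrite (dotvC (g t)) (dotvC (g t)); lra.
move=> /(jet_grad_dist (x t)); rewrite subrr dotv0l mul0r addr0.
rewrite pmulr_rle0 ?divr_gt0// => h.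
have /eqP : dotv (jet_grad (x t) - g t) (jet_grad (x t) - g t) ^+ 2 = 0.
  by apply/eqP; rewrite eq_le h sqr_ge0.
by rewrite sqrf_eq0 => /eqP/dotv_eq0/eqP; rewrite subr_eq0 => /eqP.
Qed.

Lemma C1_convex_extension : exists F : 'rV[R]_n -> R, C1_convex F /\
  forall t, A t -> F (x t) = f t /\ grad F (x t) = g t.
Proof.
exists jet_ext; split; first exact: subgradient_C1_convex jet_ext_subgradient jet_grad_continuous.
move=> t At; rewrite jet_ext_val// (subgradient_grad jet_ext_subgradient jet_grad_continuous).
by rewrite jet_ext_grad.
Qed.

End Extension.

(** * One-sided derivatives on an interval *)

Section Within.
Context {R : realType} {V : normedModType R}.
Implicit Types (D : set R) (g : R -> V) (t : R) (l : V).

(** Limits along [D] are unique only if [t] is an accumulation point of [D]; a nondegenerate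
    interval around or beside [t] ensures this. The witness lies to the right of [t] unless
    [t = b]. *)
Lemma within_dnbhs_proper D a b t : a < b -> `[a, b] `<=` D -> t \in `[a, b] ->
  ProperFilter (within D t^').
Proof.
move=> ab abD; rewrite in_itv/= => /andP[at_ tb].
apply: Build_ProperFilter_ex => P [e /= e0 eP].
have [tltb|] := ltP t b.
  pose s := Num.min b (t + e / 2).
  have ts : t < s by rewrite lt_min tltb ltrDl divr_gt0.
  have se : s <= t + e / 2 by rewrite ge_min lexx orbT.
  exists s; apply: eP => /=; first by rewrite ltr0_norm ?subr_lt0//; lra.
    by rewrite gt_eqF.
  by apply: abD; rewrite /= in_itv/= (le_trans at_ (ltW ts))/= ge_min lexx.
move=> bt; have {tb bt} tE : t = b by apply/eqP; rewrite eq_le tb.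
pose s := Num.max a (t - e / 2).
have ts : s < t by rewrite gt_max tE ab ltrBlDr ltrDl divr_gt0.
have se : t - e / 2 <= s by rewrite le_max lexx orbT.
exists s; apply: eP => /=; first by rewrite gtr0_norm ?subr_gt0//; lra.
  by rewrite lt_eqF.
by apply: abD; rewrite /= in_itv/= -tE (ltW ts) andbT le_max lexx.
Qed.

Lemma derive_within_unique D g t l : ProperFilter (within D t^') ->
  diff_quot g t s @[s --> within D t^'] --> l ->
  derivable_within D g t /\ derive_within D g t = l.
Proof. by move=> PF gl; split; [exact: cvgP gl|exact: cvg_lim gl]. Qed.

Lemma derivable_within_cvg D g t : D t -> derivable_within D g t ->
  g s @[s --> within D (nbhs t)] --> g t.
Proof.
move=> Dt dg.
have c : g s @[s --> within D t^'] --> g t.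
  have -> : g t = g t + (t - t) *: derive_within D g t.
    by rewrite subrr scale0r addr0.
  apply: (@cvg_trans _ ((fun s => g t + (s - t) *: diff_quot g t s) @ within D t^')).
    apply: near_eq_cvg; rewrite near_withinE; near=> s => _.
    have st : s - t != 0 by rewrite subr_eq0; near: s; exact: nbhs_dnbhs_neq.
    by rewrite /diff_quot scalerA mulfV// scale1r addrC subrK.
  apply: cvgD; first exact: cvg_cst.
  apply: cvgZ; last exact: dg.
  apply: cvgB; last exact: cvg_cst.
  exact: (cvg_trans (cvg_within _) (cvg_within _)).
move=> P Pt; have [e /= e0 eP] := c P Pt.
exists e => //= s ts Ds; have [->|st] := eqVneq s t.
  exact: nbhs_singleton Pt.
exact: eP.
Unshelve. all: by end_near. Qed.

Lemma derivable_within_subspace D g : (forall t, D t -> derivable_within D g t) ->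
  {within D, continuous g}.
Proof.
move=> dg; apply/subspace_continuousP => t Dt.
exact: derivable_within_cvg Dt (dg t Dt).
Qed.

(** At interior points the restriction to the interval disappears, which opens the way to the mean
    value theorem and to derivatives at extrema. *)
Lemma derivable_within_interior a b g t : t \in `]a, b[ ->
  derivable_within `[a, b] g t ->
  is_derive t 1 g (derive_within `[a, b] g t).
Proof.
rewrite in_itv/= => /andP[at_ tb] dg.
have c : h^-1 *: ((g \o shift t) (h *: 1) - g t) @[h --> 0^'] -->
    derive_within `[a, b] g t.
  apply: (@cvg_trans _ (diff_quot g t (h + t) @[h --> 0^'])).
    apply: near_eq_cvg; near=> h.
    by rewrite /diff_quot /= addrK [h *: 1]mulr1.
  apply: (@cvg_comp _ _ _ (fun h => h + t) (diff_quot g t) _ (within `[a, b] t^')) => //.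
  move=> P [e /= e0 eP].
  have m0 : 0 < Num.min e (Num.min (t - a) (b - t)).
    by rewrite !lt_min e0 !subr_gt0 at_.
  exists (Num.min e (Num.min (t - a) (b - t))); first exact: m0.
  move=> h /=.
  rewrite sub0r normrN !lt_min => /and3P[he]; rewrite !ltr_norml => /andP[h1 h2] /andP[h3 h4] h0.
  apply: eP => /=.
  - by rewrite opprD addrA addrAC subrr sub0r normrN.
  - by rewrite -subr_eq0 addrK.
  - by rewrite in_itv/=; apply/andP; split; lra.
by split; [exact: cvgP c|exact: cvg_lim c].
Unshelve. all: by end_near. Qed.

End Within.

Section WithinDot.
Context {R : realType} {n : nat}.
Implicit Types (D : set R) (g : R -> 'rV[R]_n) (u : 'rV[R]_n).

Lemma diff_quot_dotv g u t s : diff_quot (dotv u \o g) t s = dotv u (diff_quot g t s).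
Proof. by rewrite /diff_quot dotvZr dotvBr. Qed.

Lemma derive_within_dotv a b g u t : t \in `]a, b[ ->
  derivable_within `[a, b] g t ->
  is_derive t 1 (dotv u \o g) (dotv u (derive_within `[a, b] g t)).
Proof.
move=> tab dg.
have ab : a < b by move: tab; rewrite in_itv/= => /andP[]; exact: lt_trans.
have PF := within_dnbhs_proper ab (@subset_refl _ _) (subset_itv_oo_cc tab).
have c : diff_quot (dotv u \o g) t s @[s --> within `[a, b] t^'] -->
    dotv u (derive_within `[a, b] g t).
  under eq_fun do rewrite diff_quot_dotv.
  exact: (dotv_cvgr (FF := @filter_filter _ _ PF) dg).
have [d <-] := derive_within_unique PF c.
exact: derivable_within_interior.
Qed.

(** The mean value theorem fails for vector-valued curves, so it is applied to the scalar function
    [<u, g>] with [u] fixed. *)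
Lemma MVT_within a b g u s t :
  (forall t, t \in `[a, b] -> derivable_within `[a, b] g t) ->
  a <= s -> s < t -> t <= b -> exists2 r, s < r < t &
    dotv u (g t - g s) = dotv u (derive_within `[a, b] g r) * (t - s).
Proof.
move=> dg as_ st tb.
have [||r] := @MVT R (dotv u \o g) (fun r => dotv u (derive_within `[a, b] g r)) s t st.
- move=> x; rewrite in_itv/= => /andP[sx xt].
  apply: derive_within_dotv.
    by rewrite in_itv/= (le_lt_trans as_ sx) (lt_le_trans xt tb).
  apply: dg.
  by rewrite in_itv/= (ltW (le_lt_trans as_ sx)) (ltW (lt_le_trans xt tb)).
- apply: (@continuous_subspaceW _ _ _ `[a, b]).
    move=> x /=; rewrite !in_itv/= => /andP[sx xt].
    by rewrite (le_trans as_ sx) (le_trans xt tb).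
  apply/subspace_continuousP => x Dx.
  exact: (dotv_cvgr (derivable_within_cvg Dx (dg x Dx))).
- by rewrite in_itv/= => rst; rewrite dotvBr; exists r.
Qed.

End WithinDot.

(** * The potential along the curve *)

(** The square of [1 + y / 2 <= exp (y / 2)]; the left side must be nonnegative, hence [-2 <= y]. *)
Lemma expR_ge_quadratic (R : realType) (y : R) :
  -2 <= y -> 1 + y + y ^+ 2 / 4 <= expR y.
Proof.
move=> y2; have -> : expR y = expR (y / 2) ^+ 2 by rewrite -expRM_natr divfK.
have -> : 1 + y + y ^+ 2 / 4 = (1 + y / 2) ^+ 2 by field.
by rewrite ler_pXn2r ?nnegrE ?expR_ge0 ?expR_ge1Dx//; lra.
Qed.

(** On an interval of length [L], [|s - t|^(2 alpha) <= L^(2 alpha - 1) |s - t|] as soon as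
    [2 alpha >= 1]. *)
Lemma hoelder_sqr (R : realType) (n : nat) (L alpha : R) (g : R -> 'rV[R]_n) :
  0 <= L -> 2^-1 <= alpha -> hoelder_on `[0, L] alpha g ->
  exists2 C, 0 <= C & forall s t, s \in `[0, L] -> t \in `[0, L] ->
    dotv (g s - g t) (g s - g t) <= C * `|s - t|.
Proof.
move=> L0 a2 [C gC]; exists (C ^+ 2 * L `^ (2 * alpha - 1)).
  by rewrite mulr_ge0 ?sqr_ge0 ?powR_ge0.
move=> s t sL tL.
have [->|st] := eqVneq s t; first by rewrite subrr dotv0l subrr normr0 mulr0.
have e0 : 0 <= enorm (g s - g t) by exact: sqrtr_ge0.
have gst := gC s t sL tL.
rewrite -(sqr_sqrtr (dotv_ge0 _)) -/(enorm _).
have d0 : 0 < `|s - t| by rewrite normr_gt0 subr_eq0.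
have dL : `|s - t| <= L.
  move: sL tL; rewrite !in_itv/= => /andP[s0 sL] /andP[t0 tL].
  by rewrite ler_norml; apply/andP; split; lra.
have -> : C ^+ 2 * L `^ (2 * alpha - 1) * `|s - t| = C ^+ 2 * (L `^ (2 * alpha - 1) * `|s - t|).
  by rewrite mulrA.
apply: (@le_trans _ _ ((C * `|s - t| `^ alpha) ^+ 2)).
  by rewrite ler_pXn2r ?nnegrE// (le_trans e0).
rewrite exprMn ler_wpM2l ?sqr_ge0//.
rewrite -powR_mulrn ?powR_ge0// -powRrM.
have -> : alpha * 2%:R = (2 * alpha - 1) + 1 by ring.
rewrite powRD; last by rewrite (gt_eqF d0) implybT.
rewrite powRr1 ?(ltW d0)// ler_wpM2r ?(ltW d0)//.
by rewrite ge0_ler_powR ?nnegrE ?(ltW d0)//; lra.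
Qed.

(** * Scalar products of tangents with chords *)

Section Curve.
Context {R : realType} {n : nat}.
Context (L C1 : R) (gamma gamma' : R -> 'rV[R]_n).
Context (mean_value : forall u s t, 0 <= s -> s < t -> t <= L ->
  exists2 r, s < r < t & dotv u (gamma t - gamma s) = dotv u (gamma' r) * (t - s)).
Context (cgamma : {within `[0, L], continuous gamma}).
Context (cgamma' : {within `[0, L], continuous gamma'}).
Context (unit_speed : forall t, t \in `[0, L] -> dotv (gamma' t) (gamma' t) = 1).
Context (C1_ge0 : 0 <= C1).
Context (half_hoelder : forall s t, s \in `[0, L] -> t \in `[0, L] ->
  dotv (gamma' s - gamma' t) (gamma' s - gamma' t) <= C1 * `|s - t|).
Context (ssc : forall t s, t \in `[0, L] -> s \in `[0, L] -> t < s ->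
  0 < dotv (gamma' t) (gamma s - gamma t)).

Lemma dotv_unit t r : t \in `[0, L] -> r \in `[0, L] ->
  dotv (gamma' t) (gamma' r) = 1 - dotv (gamma' t - gamma' r) (gamma' t - gamma' r) / 2.
Proof.
move=> tL rL; rewrite dotvBB (unit_speed tL) (unit_speed rL).
by move: (dotv _ _) => a; lra.
Qed.

Lemma advance_le x t s : x \in `[0, L] -> t \in `[0, L] -> s \in `[0, L] -> t < s ->
  dotv (gamma' x) (gamma s - gamma t) <= s - t.
Proof.
move=> xL; rewrite !in_itv/= => /andP[t0 tL] /andP[s0 sL] ts.
have [r /andP[tr rs] ->] := mean_value (gamma' x) t0 ts sL.
have rL : r \in `[0, L] by rewrite in_itv/=; apply/andP; split; lra.
rewrite dotv_unit// ler_piMl ?subr_ge0 ?(ltW ts)//.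
by have := dotv_ge0 (gamma' x - gamma' r); move: (dotv _ _) => a; lra.
Qed.

Lemma advance_ge t s : t \in `[0, L] -> s \in `[0, L] -> t < s ->
  s - t - C1 * (s - t) ^+ 2 / 2 <= dotv (gamma' t) (gamma s - gamma t).
Proof.
move=> tI sI ts.
have := tI; have := sI; rewrite !in_itv/= => /andP[s0 sL] /andP[t0 tL].
have [r /andP[tr rs] ->] := mean_value (gamma' t) t0 ts sL.
have rL : r \in `[0, L] by rewrite in_itv/=; apply/andP; split; lra.
rewrite dotv_unit//; have := half_hoelder tI rL.
move: (dotv _ _) => a; rewrite ltr0_norm ?subr_lt0// opprB => h.
have h2 : C1 * (r - t) <= C1 * (s - t) by rewrite ler_wpM2l//; lra.
have st0 : 0 <= s - t by rewrite subr_ge0 ltW.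
have := ler_wpM2r st0 (le_trans h h2); lra.
Qed.

(** Compactness on the full square: [h] is continuous and positive there, and it equals the scalar
    product wherever [d <= s - t]. Its minimum is the bound. *)
Lemma advance_far d : 0 < d -> exists2 m, 0 < m & forall t s,
  t \in `[0, L] -> s \in `[0, L] -> d <= s - t ->
  m <= dotv (gamma' t) (gamma s - gamma t).
Proof.
move=> d0.
have [L0|L0] := ltP L 0.
  by exists 1 => // t s; rewrite !in_itv/= => /andP[t0 tL]; lra.
pose K := `[0, L]%classic `*` `[0, L]%classic.
pose w (p : R * R) := d - (p.2 - p.1).
(* [`|w p| + w p] vanishes exactly where [d <= p.2 - p.1]. *)
pose h p := `|dotv (gamma' p.1) (gamma p.2 - gamma p.1)| + (`|w p| + w p).
have K0 : K !=set0 by exists (0, 0); split; rewrite /= in_itv/= lexx L0.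
have cK : compact K by apply: compact_setX; exact: segment_compact.
have ch : {within K, continuous h}.
  apply/subspace_continuousP => -[t s] [/= tL sL].
  have c1 : fst @ within K (nbhs (t, s)) --> within `[0, L] (nbhs t).
    move=> P Pt; exists ([set x | `[0, L]%classic x -> P x], setT).
      by split=> //; exact: filterT.
    by move=> [x y] /= [Px _] [/= xL _]; exact: Px.
  have c2 : snd @ within K (nbhs (t, s)) --> within `[0, L] (nbhs s).
    move=> P Ps; exists (setT, [set x | `[0, L]%classic x -> P x]).
      by split=> //; exact: filterT.
    by move=> [x y] /= [_ Py] [/= _ yL]; exact: Py.
  have cg x : x \in `[0, L] -> gamma @ within `[0, L] (nbhs x) --> gamma x.
    by move=> xL; move/subspace_continuousP : cgamma; exact.
  have cg' : gamma' @ within `[0, L] (nbhs t) --> gamma' t.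
    by move/subspace_continuousP : cgamma'; apply.
  have c3 : w p @[p --> within K (nbhs (t, s))] --> w (t, s).
    apply: cvgB; first exact: cvg_cst.
    by apply: cvgB; [exact: cvg_trans c2 (cvg_within _)|exact: cvg_trans c1 (cvg_within _)].
  apply: cvgD; last by apply: cvgD => //; exact: cvg_norm.
  apply: cvg_norm; apply: (dotv_cvg (f := gamma' \o fst) (g := fun p => gamma p.2 - gamma p.1)).
    exact: cvg_comp c1 cg'.
  apply: cvgB; first exact: cvg_comp c2 (cg s sL).
  exact: cvg_comp c1 (cg t tL).
have [[t0 s0]] := compact_EVT_min K0 cK ch.
rewrite inE => -[/= t0L s0L] hmin.
exists (h (t0, s0)).
  rewrite /h /=; have [ds|ds] := leP d (s0 - t0).
    rewrite ltr_pwDl ?normr_gt0 ?gt_eqF// ?ssc//; first lra.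
    by rewrite -lerBlDr sub0r -normrN ler_norm.
  by rewrite ltr_wpDl// addr_gt0 ?normr_gt0 ?gt_eqF// /w /= subr_gt0.
move=> t s tL sL dts.
have := hmin (t, s); rewrite inE => /(_ (conj tL sL)) /le_trans; apply.
have w0 : w (t, s) <= 0 by rewrite subr_le0.
rewrite /h (ler0_norm w0) addNr addr0 /= gtr0_norm// ssc//; lra.
Qed.

(** Put [x = s - t]. If [x >= d], then [k m >= 2] beats the [-1]. If [x < d] and [k x <= 2], the
    quadratic bound on the exponential beats the error [k C1 x^2 / 2] of [advance_ge]. If [x < d]
    and [k x > 2], then [C1 x <= 1/2] makes the last term at least [3 k x / 4], which exceeds 1 by
    [k x / 4]. *)
Lemma exp_gap : exists k c, [/\ 0 < k, 0 < c & forall t s,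
  t \in `[0, L] -> s \in `[0, L] -> t < s ->
  c * (s - t) ^+ 2 <=
    expR (- (k * (s - t))) - 1 + k * dotv (gamma' t) (gamma s - gamma t)].
Proof.
pose d := (2 * (C1 + 1))^-1.
have d0 : 0 < d by rewrite invr_gt0; have := C1_ge0; lra.
have [m m0 mP] := advance_far d0.
(* The first summand serves the range [x < d], the second the range [x >= d]. *)
pose k := 8 * (C1 + 1) + 2 / m.
have k8 : 8 * (C1 + 1) <= k by rewrite lerDl divr_ge0// ltW.
have k0 : 0 < k by have := C1_ge0; lra.
have km : 2 <= k * m.
  rewrite /k mulrDl divfK ?gt_eqF// lerDr mulr_ge0// ?ltW//; have := C1_ge0; lra.
(* Small enough that [c x^2] is at most each of [1], [x^2] and [x] for [0 < x <= L], one bound for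
   each range. *)
pose c := (`|L| ^+ 2 + `|L| + 1)^-1.
have q1 : 1 <= `|L| ^+ 2 + `|L| + 1 by rewrite lerDr addr_ge0 ?sqr_ge0.
have c0 : 0 < c by rewrite invr_gt0 (lt_le_trans ltr01).
exists k, c; split=> // t s tL sL ts.
have := tL; have := sL; rewrite !in_itv/= => /andP[s0 sL'] /andP[t0 tL'].
set x := s - t; have x0 : 0 < x by rewrite subr_gt0.
have L0 : 0 <= L by lra.
have xL : x <= L by rewrite /x; lra.
have c1 : c * x ^+ 2 <= 1.
  rewrite ler_pdivrMl ?(lt_le_trans ltr01)// mulr1 ger0_norm//.
  have : x ^+ 2 <= L ^+ 2 by rewrite ler_pXn2r ?nnegrE ?(ltW x0).
  lra.
have c2 : c * x ^+ 2 <= x ^+ 2.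
  by rewrite ler_piMl ?sqr_ge0// invf_le1// (lt_le_trans ltr01).
have c3 : c * x ^+ 2 <= x.
  rewrite ler_pdivrMl ?(lt_le_trans ltr01)// ger0_norm// expr2 ler_wpM2r ?(ltW x0)//.
  have := sqr_ge0 L; lra.
have [dx|xd] := leP d x.
  have := mP _ _ tL sL dx => h; have := ler_wpM2l (ltW k0) h.
  have := expR_ge0 (- (k * x)); lra.
have := advance_ge tL sL ts; rewrite -/x => h.
have {}h := ler_wpM2l (ltW k0) h.
have [x2|x2] := leP (k * x) 2.
  have := @expR_ge_quadratic _ (- (k * x)); rewrite lerN2 => /(_ x2).
  have : 2 * (C1 + 1) * (k * x ^+ 2) <= k / 4 * (k * x ^+ 2).
    by rewrite ler_wpM2r ?mulr_ge0 ?sqr_ge0 ?(ltW k0)//; lra.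
  have : 1 * x ^+ 2 <= k * x ^+ 2 by rewrite ler_wpM2r ?sqr_ge0//; have := C1_ge0; lra.
  have : 0 <= C1 * (k * x ^+ 2) by rewrite !mulr_ge0 ?(ltW k0) ?(ltW x0).
  nra.
have := expR_ge0 (- (k * x)).
have : C1 * x <= 2^-1.
  move: xd; rewrite /d invfM; set e := (C1 + 1)^-1 => xe.
  have : C1 * e <= 1 by rewrite ler_pdivrMr ?mul1r; have := C1_ge0; lra.
  have := ler_wpM2l C1_ge0 (ltW xe); lra.
move=> /(ler_wpM2r (ltW (mulr_gt0 k0 x0))).
have : 8 * x <= k * x by rewrite ler_wpM2r ?(ltW x0)//; have := C1_ge0; lra.
nra.
Qed.

(** * The 1-jet along the curve and its convexity gap *)

Section Potential.
Context (k c : R).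
Context (k_gt0 : 0 < k).
Context (c01 : 0 <= c <= 1).

(** [speed], [potential] and [slope] are [h], [F] and [G] of the overview, for any [c] between 0 and
    1. *)
Definition speed t := expR (k * (L - t)) - c.

Definition potential t := expR (k * (L - t)) / k + c * t.

Definition slope t := - (speed t *: gamma' t).

Lemma expR_decay_ge1 t : t <= L -> 1 <= expR (k * (L - t)).
Proof.
by move=> tL; rewrite -expR0 ler_expR mulr_ge0 ?subr_ge0 ?(ltW k_gt0).
Qed.

Lemma speed_ge0 t : t <= L -> 0 <= speed t.
Proof.
by move=> tL; rewrite subr_ge0 (le_trans _ (expR_decay_ge1 tL))//; case/andP: c01.
Qed.

Lemma potential_gap c0 :
  (forall t s, t \in `[0, L] -> s \in `[0, L] -> t < s ->
    c0 * (s - t) ^+ 2 <=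
      expR (- (k * (s - t))) - 1 + k * dotv (gamma' t) (gamma s - gamma t)) ->
  0 < c0 ->
  forall s t, s \in `[0, L] -> t \in `[0, L] ->
    Num.min (c0 / k) (k / 4) * (s - t) ^+ 2 <=
      potential s - potential t - dotv (slope t) (gamma s - gamma t).
Proof.
move=> gap c00 s t sI tI; rewrite dotvNl dotvZl opprK /potential /speed.
have /andP[c_ge0 c_le1] := c01.
have := sI; have := tI; rewrite !in_itv/= => /andP[t0 tL] /andP[s0 sL].
have [st|ts|->] := ltgtP s t; last by rewrite !subrr dotv0r mulr0 expr0n !mulr0 addr0.
- apply: (@le_trans _ _ (k / 4 * (s - t) ^+ 2)).
    by rewrite ler_wpM2r ?sqr_ge0// ge_min lexx orbT.
  have adv := advance_le tI sI tI st.
  have adv0 : 0 <= t - s - dotv (gamma' t) (gamma t - gamma s) by rewrite subr_ge0.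
  have := mulr_ge0 (speed_ge0 tL) adv0; rewrite /speed -(opprB (gamma s)) dotvNr.
  have -> : k * (L - s) = k * (L - t) + k * (t - s) by ring.
  rewrite expRD; set E := expR (k * (L - t)); set v := dotv _ _ => hp.
  have E1 : 1 <= E by exact: expR_decay_ge1.
  have y0 : 0 <= k * (t - s) by rewrite mulr_ge0 ?subr_ge0 ?ltW.
  have := @expR_ge_quadratic _ (k * (t - s)); set Y := expR _ => hY.
  have {}hY : 1 + k * (t - s) + (k * (t - s)) ^+ 2 / 4 <= Y by apply: hY; lra.
  have h1 : (k * (t - s)) ^+ 2 / 4 <= E * (Y - 1 - k * (t - s)).
    have p : 0 <= Y - 1 - k * (t - s).
      by apply: le_trans (sqr_ge0 (k * (t - s) / 2)) _; rewrite expr_div_n; lra.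
    by have := ler_wpM2r p E1; lra.
  rewrite -(ler_pM2l k_gt0).
  (* As [v >= s - t] and [E - c >= 0], replacing [v] by [s - t] cancels the terms in [c] and leaves
     [E (Y - 1 - k (t - s))], which [h1] bounds below. *)
  have -> : k * (E * Y / k + c * s - (E / k + c * t) + (E - c) * v) =
     E * (Y - 1) + k * (c * (s - t)) + k * ((E - c) * v) by field; rewrite gt_eqF.
  have := ler_wpM2l (ltW k_gt0) hp; rewrite mulr0.
  nra.
- apply: (@le_trans _ _ (c0 / k * (s - t) ^+ 2)).
    by rewrite ler_wpM2r ?sqr_ge0// ge_min lexx.
  have adv := advance_le tI tI sI ts.
  have := gap _ _ tI sI ts; set v := dotv _ _ in adv *.
  have -> : k * (L - s) = k * (L - t) - k * (s - t) by ring.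
  rewrite expRD; set E := expR (k * (L - t)); set Y := expR _ => hY.
  have E1 : 1 <= E by exact: expR_decay_ge1.
  rewrite -(ler_pM2l k_gt0).
  (* The first summand is the expression of [exp_gap] scaled by [E >= 1]; the second is nonnegative
     by unit speed. *)
  have -> : k * (E * Y / k + c * s - (E / k + c * t) + (E - c) * v) =
     E * (Y - 1 + k * v) + c * (k * (s - t - v)) by field; rewrite gt_eqF.
  have -> : k * (c0 / k * (s - t) ^+ 2) = c0 * (s - t) ^+ 2 by field; rewrite gt_eqF.
  have p : 0 <= c0 * (s - t) ^+ 2 by rewrite mulr_ge0 ?sqr_ge0 ?ltW.
  have : 1 * (Y - 1 + k * v) <= E * (Y - 1 + k * v) by rewrite ler_wpM2r// (le_trans p).
  have : 0 <= c * (k * (s - t - v)) by rewrite !mulr_ge0 ?(ltW k_gt0) ?subr_ge0.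
  lra.
Qed.

Lemma speed_le t : 0 <= t -> speed t <= expR (k * L).
Proof.
move=> t0; have /andP[c_ge0 _] := c01.
have : expR (k * (L - t)) <= expR (k * L) by rewrite ler_expR ler_pM2l//; lra.
by rewrite /speed; lra.
Qed.

Lemma speed_lip s t : 0 <= s -> s <= t ->
  0 <= speed s - speed t <= k * expR (k * L) * (t - s).
Proof.
move=> s0 st.
have E0 : expR (k * (L - s)) <= expR (k * L) by rewrite ler_expR ler_pM2l//; lra.
have -> : speed s - speed t = expR (k * (L - s)) * (1 - expR (- (k * (t - s)))).
  rewrite /speed (_ : k * (L - t) = k * (L - s) - k * (t - s)); last by ring.
  by rewrite expRD; ring.
have y0 : 0 <= k * (t - s) by rewrite mulr_ge0 ?subr_ge0 ?(ltW k_gt0).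
have h0 : 0 <= 1 - expR (- (k * (t - s))) by rewrite subr_ge0 -expR0 ler_expR oppr_le0.
rewrite mulr_ge0 ?expR_ge0//=.
have -> : k * expR (k * L) * (t - s) = expR (k * L) * (k * (t - s)) by ring.
apply: ler_pM; rewrite ?expR_ge0//.
have := @expR_ge1Dx _ (- (k * (t - s))); lra.
Qed.

(** The change of [slope] splits into a Lipschitz part, from [speed], and a 1/2-Hoelder part, from
    the tangent. Hence its squared norm is [O(|s - t|)], and its fourth power is controlled by the
    quadratic margin. *)
Lemma slope_dist : exists2 C, 0 < C & forall s t, s \in `[0, L] -> t \in `[0, L] ->
  dotv (slope t - slope s) (slope t - slope s) ^+ 2 <= C * (s - t) ^+ 2.
Proof.
set E := expR (k * L); have E0 : 0 < E by exact: expR_gt0.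
pose C := 2 * (k * E) ^+ 2 * `|L| + 2 * E ^+ 2 * C1.
have C0 : 0 <= C by rewrite addr_ge0 ?mulr_ge0 ?(ltW k_gt0) ?(ltW E0).
(* The [+ 1] keeps the constant positive, as it becomes a divisor in [exists_potential]. *)
exists (C ^+ 2 + 1); first by rewrite ltr_wpDl ?sqr_ge0.
suff H s t : s \in `[0, L] -> t \in `[0, L] -> s <= t ->
    dotv (slope t - slope s) (slope t - slope s) ^+ 2 <= (C ^+ 2 + 1) * (s - t) ^+ 2.
  move=> s t sI tI; have [st|ts] := leP s t; first exact: H.
  by have := H _ _ tI sI (ltW ts); rewrite -(opprB (slope t)) dotvNl dotvNr opprK -(opprB s) sqrrN.
move=> sI tI st.
have := sI; have := tI; rewrite !in_itv/= => /andP[t0 tL] /andP[s0 sL].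
apply: (@le_trans _ _ ((C * (t - s)) ^+ 2)); last first.
  by rewrite exprMn -(opprB t) sqrrN ler_wpM2r ?sqr_ge0// lerDl.
rewrite ler_pXn2r ?nnegrE ?dotv_ge0 ?mulr_ge0 ?subr_ge0//.
pose u := (speed s - speed t) *: gamma' s; pose v := speed t *: (gamma' s - gamma' t).
have -> : slope t - slope s = u + v.
  by rewrite /slope /u /v; apply/rowP => i; rewrite !mxE; ring.
apply: (@le_trans _ _ (2 * dotv u u + 2 * dotv v v)).
  have := dotv_ge0 (u - v); rewrite !(dotvBl, dotvBr, dotvDl, dotvDr) (dotvC v u); lra.
have /andP[h0 h1] := speed_lip s0 st.
have u1 : dotv u u <= (k * E) ^+ 2 * `|L| * (t - s).
  rewrite /u dotvZl dotvZr unit_speed// mulr1 -expr2.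
  apply: (@le_trans _ _ ((k * E * (t - s)) ^+ 2)).
    by rewrite ler_pXn2r ?nnegrE// (le_trans h0).
  rewrite exprMn -mulrA ler_wpM2l ?sqr_ge0// expr2 ler_wpM2r ?subr_ge0//.
  by apply: le_trans (ler_norm _); lra.
have v1 : dotv v v <= E ^+ 2 * C1 * (t - s).
  rewrite /v dotvZl dotvZr mulrA -expr2 -mulrA.
  apply: ler_pM; rewrite ?sqr_ge0 ?dotv_ge0//.
    by rewrite ler_pXn2r ?nnegrE ?speed_ge0 ?expR_ge0// speed_le.
  by have := half_hoelder sI tI; rewrite ler0_norm ?subr_le0// opprB.
rewrite /C; lra.
Qed.

Lemma curve_bounded : exists M, forall t, t \in `[0, L] ->
  [/\ dotv (gamma t) (gamma t) <= M, dotv (slope t) (slope t) <= M &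
      `|potential t| <= M].
Proof.
set E := expR (k * L); have E0 : 0 < E by exact: expR_gt0.
have /andP[c_ge0 c_le1] := c01.
exists (2 * L ^+ 2 + 2 * dotv (gamma 0) (gamma 0) + E ^+ 2 + (E / k + `|L|)) => t tI.
have := tI; rewrite in_itv/= => /andP[t0 tL].
have b1 : 0 <= 2 * L ^+ 2 + 2 * dotv (gamma 0) (gamma 0).
  by have := sqr_ge0 L; have := dotv_ge0 (gamma 0); lra.
have b2 : 0 <= E / k + `|L| by rewrite addr_ge0 ?divr_ge0 ?expR_ge0 ?(ltW k_gt0).
have b3 := sqr_ge0 E.
split.
- suff : dotv (gamma t - gamma 0) (gamma t - gamma 0) <= L ^+ 2.
    have := dotv_ge0 (gamma t - 2 *: gamma 0).
    rewrite !(dotvBl, dotvBr, dotvZl, dotvZr) (dotvC (gamma 0)); lra.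
  have [->|tn0] := eqVneq t 0; first by rewrite subrr dotv0l sqr_ge0.
  have tp : 0 < t by rewrite lt_def tn0.
  (* Testing the mean value against the chord itself turns its squared length into
     [t <chord, gamma' r>], at most half of [t^2] plus that squared length. *)
  have [r /andP[r0 rt] E1] := mean_value (gamma t - gamma 0) (lexx 0) tp tL.
  have rI : r \in `[0, L] by rewrite in_itv/=; apply/andP; split; lra.
  have := dotv_CS (gamma t - gamma 0) (gamma' r); rewrite unit_speed// mulr1.
  have := sqr_ge0 (L - t); have := sqr_ge0 t.
  move: E1; rewrite subr0; set q := dotv _ _; set w := dotv _ (gamma' r) => E1 h1 h2 h3.
  have tt : t ^+ 2 <= L ^+ 2 by rewrite ler_pXn2r ?nnegrE ?(ltW tp)// (le_trans t0).
  have := dotv_young (t *: gamma' r) (gamma t - gamma 0).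
  have := ler_norm (dotv (t *: gamma' r) (gamma t - gamma 0)).
  rewrite !dotvZl dotvZr unit_speed// (dotvC (gamma' r)) -/q -/w mulr1; lra.
- rewrite /slope dotvNl dotvNr opprK dotvZl dotvZr unit_speed// mulr1 -expr2.
  have : speed t ^+ 2 <= E ^+ 2.
    by rewrite ler_pXn2r ?nnegrE ?speed_ge0 ?expR_ge0// speed_le.
  lra.
- have p1 : 0 <= expR (k * (L - t)) / k <= E / k.
    rewrite divr_ge0 ?expR_ge0 ?(ltW k_gt0)//= ler_pM2r ?invr_gt0// ler_expR ler_pM2l//; lra.
  have p2 : 0 <= c * t by rewrite mulr_ge0.
  have p3 : c * t <= `|L| by apply: le_trans (ler_norm _); apply: le_trans tL; rewrite ler_piMl.
  move/andP: p1 => [p1 p1']; rewrite /potential ger0_norm ?addr_ge0//; lra.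
Qed.

End Potential.

(** [k] is fixed before [c], since [exp_gap] does not involve [c]. *)
Lemma exists_potential : 0 <= L -> exists2 k, 0 < k & forall c, 0 <= c <= 1 ->
  exists2 f : 'rV[R]_n -> R, C1_convex f &
    forall t, t \in `[0, L] -> grad f (gamma t) = slope k c t.
Proof.
move=> L0; have [k [c0 [k0 c00 gap]]] := exp_gap.
exists k => // c c01.
have [C C0 CP] := slope_dist k0 c01.
have [M MP] := curve_bounded k0 c01.
set m := Num.min (c0 / k) (k / 4).
have m0 : 0 < m by rewrite lt_min !divr_gt0.
have [||||||f [fC fP]] := @C1_convex_extension R n R `[0, L]%classic gamma (slope k c)
    (potential k c) (m / C) M.
- by exists 0; rewrite /= in_itv/= lexx.
- by rewrite divr_gt0.
- by move=> t tL; have [] := MP t tL.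
- by move=> t tL; have [] := MP t tL.
- by move=> t tL; have [] := MP t tL.
(* The margin [m (s - t)^2] dominates [m / C] times the fourth power of the slope difference. *)
- move=> s t sL tL; apply: le_trans (potential_gap k0 c01 gap c00 sL tL).
  rewrite -/m -mulrA ler_wpM2l ?(ltW m0)// mulrC ler_pdivrMr// mulrC.
  exact: CP.
by exists f => // t tL; have [] := fP t tL.
Qed.

End Curve.

(** * Reparametrization in time *)

Section Reparam.
Context {R : realType} {V : normedModType R}.
Context (A B : set R) (g : R -> V) (eta : R -> R) (h t : R).
Context (etaA : forall s, B s -> A (eta s)).
Context (eta_inj : forall s, B s -> s != t -> eta s != eta t).
Context (deta : is_derive t 1 eta h).

Lemma is_derive_diff_quot : diff_quot (eta : R -> R^o) t s @[s --> t^'] --> h.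
Proof.
have [dv <-] := deta.
apply: (@cvg_trans _ ((fun s => (s - t)^-1 *: (eta ((s - t) *: 1 + t) - eta t) : R) @ t^')).
  by apply: near_eq_cvg; near=> s; rewrite /diff_quot [(s - t) *: 1]mulr1 subrK.
apply: (@cvg_comp _ _ _ (fun s => s - t) (fun x => x^-1 *: (eta (x *: 1 + t) - eta t)) _ 0^') dv.
move=> P [e /= e0 eP]; exists e => //= s ts st; apply: eP => /=.
  by rewrite sub0r opprB.
by rewrite subr_eq0.
Unshelve. all: by end_near. Qed.

Lemma reparam_derive_within : ProperFilter (within B t^') -> B t ->
  derivable_within A g (eta t) ->
  derivable_within B (g \o eta) t /\
  derive_within B (g \o eta) t = h *: derive_within A g (eta t).
Proof.
move=> PF Bt dg; apply: derive_within_unique.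
(* The quotient of [g \o eta] factors exactly into those of [eta] and [g]: injectivity of [eta]
   excludes a zero denominator. *)
apply: (@cvg_trans _ ((fun s =>
  diff_quot (eta : R -> R^o) t s *: diff_quot g (eta t) (eta s)) @ within B t^')).
  apply: near_eq_cvg; rewrite near_withinE; near=> s => Bs.
  have st : s != t by near: s; exact: nbhs_dnbhs_neq.
  rewrite /diff_quot scalerA -mulrA mulfV ?mulr1// subr_eq0; exact: eta_inj.
apply: cvgZ; 
  first by apply: cvg_trans is_derive_diff_quot; apply: cvg_fmap2; exact: cvg_within.
apply: (@cvg_comp _ _ _ eta (diff_quot g (eta t)) _ (within A (eta t)^')) dg.
have ceta : {for t, continuous eta}.
  by apply: differentiable_continuous; apply/derivable1_diffP; case: deta.
move=> P [e e0 eP].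
have H := @cvgr_dist_lt _ _ _ (nbhs t) _ eta (eta t) ceta e e0.
suff : \forall s \near t^', B s -> P (eta s) by [].
near=> s => Bs.
have st : s != t by near: s; exact: nbhs_dnbhs_neq.
apply: eP; [|exact: eta_inj|exact: etaA] => /=.
by near: s; apply: cvg_within; exact: H.
Unshelve. all: by end_near. Qed.

End Reparam.

Lemma is_derive_within_continuous (R : realType) (D : set R) (f df : R -> R) :
  (forall t, D t -> is_derive t 1 f (df t)) -> {within D, continuous f}.
Proof.
move=> dfD; apply/subspace_continuousP => t Dt; apply: cvg_within_filter.
by apply: differentiable_continuous; apply/derivable1_diffP; case: (dfD t Dt).
Qed.

(** * Explicit time changes for finite and infinite time *)

Section LogTime.
Context {R : realType}.
Context (k L : R).
Context (k0 : 0 < k).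

(* If [w' = k (1 - c w)] then [L + ln w / k] solves [eta' = exp (k (L - eta)) - c]. *)
Definition log_pos (w : R -> R) t := L + ln (w t) / k.

Lemma expR_log_pos w t : 0 < w t -> expR (k * (L - log_pos w t)) = (w t)^-1.
Proof.
move=> w0; rewrite /log_pos opprD addrA subrr sub0r mulrN mulrC divfK ?gt_eqF//.
by rewrite expRN lnK.
Qed.

Lemma is_derive_log_pos (c : R) (w : R -> R) (t : R) :
  0 < w t -> is_derive t 1 w (k * (1 - c * w t)) ->
  is_derive t 1 (log_pos w) (expR (k * (L - log_pos w t)) - c).
Proof.
move=> w0 dw; rewrite expR_log_pos//.
have -> : log_pos w = cst L + k^-1 \*: (@ln R \o w).
  by apply/funext => s; rewrite /log_pos /= mulrC.
have dl := is_derive1_ln w0.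
have d := is_derive1_comp dl dw.
apply: (is_derive_eq (is_deriveD (is_derive_cst L t 1) (is_deriveZ k^-1 d))).
rewrite add0r /GRing.scale /=; field.
by rewrite !gt_eqF.
Qed.

Lemma log_pos_expR w t s : w t = expR (- (k * (L - s))) -> log_pos w t = s.
Proof. by rewrite /log_pos => ->; rewrite expRK; field; rewrite gt_eqF. Qed.

Context (L0 : 0 < L).

(** The solution [w] for [c = 0] with [w 0 = exp (- k L)], that is, starting from position 0.
    [fin_time] inverts the resulting position. *)
Definition fin_weight t := k * t + expR (- (k * L)).
Definition fin_time s := (expR (- (k * (L - s))) - expR (- (k * L))) / k.

Lemma fin_weight_gt0 t : 0 <= t -> 0 < fin_weight t.
Proof. by move=> t0; rewrite ltr_wpDl ?expR_gt0// mulr_ge0 ?(ltW k0). Qed.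

Lemma is_derive_fin_weight (t : R) : is_derive t 1 fin_weight (k * (1 - 0 * fin_weight t)).
Proof.
have -> : fin_weight = k \*: id + cst (expR (- (k * L))) by [].
by apply: is_derive_eq; rewrite addr0 mul0r subr0.
Qed.

Lemma fin_time_lt s s' : s < s' -> fin_time s < fin_time s'.
Proof.
move=> ss; rewrite ltr_pM2r ?invr_gt0// ltrD2r ltr_expR ltrN2 ltr_pM2l//; lra.
Qed.

Lemma fin_time0 : fin_time 0 = 0.
Proof. by rewrite /fin_time subr0 subrr mul0r. Qed.

Lemma fin_weightK s : log_pos fin_weight (fin_time s) = s.
Proof.
by apply: log_pos_expR; rewrite /fin_weight /fin_time; field; rewrite gt_eqF.
Qed.

Lemma fin_timeK t : 0 <= t -> fin_time (log_pos fin_weight t) = t.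
Proof.
move=> t0; rewrite /fin_time expRN expR_log_pos ?fin_weight_gt0// invrK /fin_weight.
by field; rewrite gt_eqF.
Qed.

Lemma fin_homeo : increasing_homeo `[0, L] `[0, fin_time L] fin_time (log_pos fin_weight).
Proof.
have mono s s' : (fin_time s <= fin_time s') = (s <= s').
  exact: (le_mono (fun x y xy => fin_time_lt xy)).
split.
- move=> s /=; rewrite !in_itv/= => /andP[s0 sL]; rewrite fin_weightK.
  by rewrite -fin_time0 !mono s0.
- move=> t /=; rewrite !in_itv/= => /andP[t0 tL].
  rewrite fin_timeK//; split=> //.
  by rewrite -(mono 0) -(mono _ L) fin_time0 fin_timeK ?t0.
- by move=> s s' _ _; exact: fin_time_lt.
- apply: continuous_subspaceT => s.
  apply: cvgM; last exact: cvg_cst.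
  apply: cvgB; last exact: cvg_cst.
  apply: (@cvg_comp _ _ _ (fun s => - (k * (L - s))) expR _ (nbhs (- (k * (L - s)))));
    last exact: continuous_expR.
  apply: cvgN; apply: cvgM; first exact: cvg_cst.
  by apply: cvgB; first exact: cvg_cst.
- apply: (@is_derive_within_continuous _ _ _ (fun t => expR (k * (L - log_pos fin_weight t)) - 0)).
  move=> t /=; rewrite in_itv/= => /andP[t0 _].
  by apply: is_derive_log_pos; [exact: fin_weight_gt0|exact: is_derive_fin_weight].
Qed.

(** The solution for [c = 1] with the same initial value. It increases to 1 without reaching it, so
    the position tends to [L] in infinite time. *)
Definition inf_weight t := 1 - (1 - expR (- (k * L))) * expR (- (k * t)).
Definition inf_time s :=
  (ln (1 - expR (- (k * L))) - ln (1 - expR (- (k * (L - s))))) / k.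

Lemma inf_weight_bounds t : 0 <= t -> 0 < inf_weight t < 1.
Proof.
move=> t0; have a1 : expR (- (k * L)) < 1 by rewrite expR_lt1 oppr_lt0 mulr_gt0.
have a0 := expR_gt0 (- (k * L)); have b0 := expR_gt0 (- (k * t)).
have b1 : expR (- (k * t)) <= 1 by rewrite expR_le1 oppr_le0 mulr_ge0 ?(ltW k0).
rewrite /inf_weight; apply/andP; split; nra.
Qed.

Lemma is_derive_inf_weight (t : R) : is_derive t 1 inf_weight (k * (1 - 1 * inf_weight t)).
Proof.
have -> : inf_weight = cst 1 - (1 - expR (- (k * L))) \*: (@expR R \o (- k \*: id)).
  by apply/funext => s; rewrite /inf_weight !fctE /= /GRing.scale /= mulNr.
have d1 : is_derive t 1 (- k \*: id) (- k : R).
  by apply: is_derive_eq; rewrite /GRing.scale /= mulr1.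
have d2 := is_derive1_comp (is_derive_expR (- k * t)) d1.
have d := is_deriveB (is_derive_cst (1 : R) t 1) (is_deriveZ (1 - expR (- (k * L))) d2).
by apply: is_derive_eq d _; rewrite !fctE /= /GRing.scale /=; ring.
Qed.

Lemma inf_gap_gt0 s : s < L -> 0 < 1 - expR (- (k * (L - s))).
Proof. by move=> sL; rewrite subr_gt0 expR_lt1 oppr_lt0 mulr_gt0// subr_gt0. Qed.

Lemma inf_gap0 : 0 < 1 - expR (- (k * L)).
Proof. by have := inf_gap_gt0 L0; rewrite subr0. Qed.

Lemma inf_weightK s : s < L -> log_pos inf_weight (inf_time s) = s.
Proof.
move=> sL; apply: log_pos_expR; rewrite /inf_weight /inf_time [k * (_ / k)]mulrC divfK ?gt_eqF//.
rewrite opprB expRB !lnK ?posrE ?inf_gap0 ?inf_gap_gt0//.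
by field; rewrite gt_eqF ?inf_gap0.
Qed.

Lemma inf_timeK t : 0 <= t -> inf_time (log_pos inf_weight t) = t.
Proof.
move=> t0; have /andP[w0 w1] := inf_weight_bounds t0.
rewrite /inf_time [expR (- (k * (L - _)))]expRN expR_log_pos// invrK.
have -> : 1 - inf_weight t = (1 - expR (- (k * L))) * expR (- (k * t)).
  by rewrite /inf_weight; ring.
rewrite lnM ?posrE ?inf_gap0 ?expR_gt0// expRK; field.
by rewrite gt_eqF.
Qed.

Lemma inf_pos_lt t : 0 <= t -> log_pos inf_weight t < L.
Proof.
move=> t0; have /andP[w0 w1] := inf_weight_bounds t0.
by rewrite /log_pos gtrDl pmulr_llt0 ?invr_gt0// ln_lt0// w0.
Qed.

Lemma inf_time_lt s s' : s < s' -> s' < L -> inf_time s < inf_time s'.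
Proof.
move=> ss sL; rewrite ltr_pM2r ?invr_gt0// ltrD2l ltrN2.
rewrite ltr_ln ?posrE ?inf_gap_gt0//; last lra.
by rewrite ltrD2l ltrN2 ltr_expR ltrN2 ltr_pM2l//; lra.
Qed.

Lemma inf_time0 : inf_time 0 = 0.
Proof. by rewrite /inf_time subr0 subrr mul0r. Qed.

Lemma inf_homeo : increasing_homeo `[0, L[ `[0, +oo[ inf_time (log_pos inf_weight).
Proof.
have der (t : R) : 0 <= t -> is_derive t 1 (log_pos inf_weight)
    (expR (k * (L - log_pos inf_weight t)) - 1).
  move=> t0; have /andP[w0 _] := inf_weight_bounds t0.
  exact: is_derive_log_pos w0 (is_derive_inf_weight t).
split.
- move=> s /=; rewrite !in_itv/= => /andP[s0 sL]; rewrite inf_weightK//; split=> //.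
  rewrite andbT -inf_time0; have [->|sn0] := eqVneq s 0; first exact: lexx.
  by apply/ltW/inf_time_lt => //; rewrite lt_def sn0.
- move=> t /=; rewrite !in_itv/= andbT => t0.
  rewrite inf_timeK// inf_pos_lt// andbT; split=> //.
  rewrite leNgt; apply/negP => /inf_time_lt/(_ L0).
  by rewrite inf_timeK// inf_time0 ltNge t0.
- by move=> s s' /= _; rewrite in_itv/= => /andP[_ sL] ss; exact: inf_time_lt.
- apply/subspace_continuousP => s /=; rewrite in_itv/= => /andP[s0 sL].
  apply: cvg_within_filter; apply: cvgM; last exact: cvg_cst.
  apply: cvgB; first exact: cvg_cst.
  apply: (@continuous_cvg _ _ _ _ _ _ (@ln R) _ (continuous_ln (inf_gap_gt0 sL))).
  apply: cvgB; first exact: cvg_cst.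
  apply: (@cvg_comp _ _ _ (fun s => - (k * (L - s))) expR _ (nbhs (- (k * (L - s)))));
    last exact: continuous_expR.
  apply: cvgN; apply: cvgM; first exact: cvg_cst.
  by apply: cvgB; first exact: cvg_cst.
- apply: (@is_derive_within_continuous _ _ _ (fun t => expR (k * (L - log_pos inf_weight t)) - 1)).
  by move=> t /=; rewrite in_itv/= andbT; exact: der.
Qed.

Lemma inf_pos_cvg : log_pos inf_weight t @[t --> +oo] --> L.
Proof.
have c1 : expR (- (k * t)) @[t --> +oo] --> (0 : R).
  apply: (@cvg_comp _ _ _ (fun t => k * t) (fun x => expR (- x)) _ +oo); last exact: cvgr_expR.
  exact: gt0_cvgMry.
have c2 : inf_weight t @[t --> +oo] --> (1 : R).
  have -> : (1 : R) = 1 - (1 - expR (- (k * L))) * 0 by rewrite mulr0 subr0.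
  by apply: cvgB; [exact: cvg_cst|apply: cvgM => //; exact: cvg_cst].
have -> : L = L + ln 1 / k by rewrite ln1 mul0r addr0.
apply: cvgD; first exact: cvg_cst.
apply: cvgM; last exact: cvg_cst.
by apply: (@continuous_cvg _ _ _ _ _ _ (@ln R) _ (continuous_ln (@ltr01 R))).
Qed.

End LogTime.

(** * Gradient curves are strongly self-contracted *)

Lemma enorm_cvg (R : realType) (n : nat) (T : Type) (F : set_system T) (FF : Filter F)
    (f : T -> 'rV[R]_n) v :
  f @ F --> v -> enorm (f x) @[x --> F] --> enorm v.
Proof.
move=> fv; have c : {for dotv v v, continuous (@Num.sqrt R)} by exact: sqrt_continuous.
by apply: (@continuous_cvg _ _ _ _ _ _ (@Num.sqrt R) _ c); exact: dotv_cvg.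
Qed.

Lemma enormZ (R : realType) (n : nat) (a : R) (v : 'rV[R]_n) :
  0 <= a -> enorm (a *: v) = a * enorm v.
Proof.
by move=> a0; rewrite /enorm dotvZl dotvZr mulrA -expr2 sqrtrM ?sqr_ge0// sqrtr_sqr ger0_norm.
Qed.

Section Flow.
Context {R : realType} {n : nat}.
Context (T : R) (f : 'rV[R]_n -> R) (g : R -> 'rV[R]_n).
Context (fC : C1_convex f).
Context (flow : gradient_curve `[0, T] f g).

Lemma flow_is_derive t : t \in `]0, T[ ->
  is_derive t 1 (f \o g) (- dotv (grad f (g t)) (grad f (g t))).
Proof.
move=> t0T; have [dg dgE] := flow (subset_itv_oo_cc t0T).
have [df _ _] := fC.
have := derivable_within_interior t0T dg; rewrite dgE => dgt.
have dgd : differentiable g t by apply/derivable1_diffP; case: dgt.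
split.
  by apply: diff_derivable; exact: differentiable_comp.
rewrite deriveE; last exact: differentiable_comp.
rewrite diff_comp//= -[X in 'd f _ X]deriveE// derive_val -deriveE//.
by rewrite deriveE_grad// dotvNr.
Qed.

Lemma flow_mean_value s t : 0 <= s -> s < t -> t <= T -> exists2 r, s < r < t &
  f (g t) - f (g s) = - dotv (grad f (g r)) (grad f (g r)) * (t - s).
Proof.
move=> s0 st tT.
have [x|r|r] := @MVT R (f \o g) (fun r => - dotv (grad f (g r)) (grad f (g r))) s t st.
- rewrite in_itv/= => /andP[sx xt]; apply: flow_is_derive.
  by rewrite in_itv/=; apply/andP; split; lra.
- apply: (@continuous_subspaceW _ _ _ `[0, T]).
    by move=> x /=; rewrite !in_itv/= => /andP[sx xt]; apply/andP; split; lra.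
  apply/subspace_continuousP => x xT; have [dg _] := flow xT.
  apply: (continuous_cvg _ _ (derivable_within_cvg xT dg)).
  by have [df _ _] := fC; exact: differentiable_continuous.
- by rewrite in_itv/= => rst E; exists r.
Qed.

Lemma flow_nincr s t : 0 <= s -> s <= t -> t <= T -> f (g t) <= f (g s).
Proof.
move=> s0; rewrite le_eqVlt => /predU1P[->//|st] tT.
have [r _] := flow_mean_value s0 st tT.
have st0 : 0 <= t - s by rewrite subr_ge0 ltW.
by have := mulr_ge0 (dotv_ge0 (grad f (g r))) st0; rewrite mulNr; lra.
Qed.

(** The nonincreasing [f \o g] has equal values at [s] and [t], so it is constant between them, and
    its derivative [- |grad f|^2] vanishes there. *)
Lemma flow_stationary s t : 0 <= s -> t <= T -> f (g s) = f (g t) ->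
  forall r, s < r < t -> grad f (g r) = 0.
Proof.
move=> s0 tT fst r /andP[sr rt]; apply: dotv_eq0.
have cst x : s <= x <= t -> f (g x) = f (g s).
  move=> /andP[sx xt]; apply/eqP; rewrite eq_le flow_nincr//=; last lra.
  by rewrite fst flow_nincr//; lra.
have d : is_derive r 1 (f \o g) 0.
  (* Every interior point minimises a constant function. *)
  apply: (@derive1_at_min _ _ s t) => //; first by rewrite ltW// (lt_trans sr).
  - move=> x; rewrite in_itv/= => /andP[sx xt].
    have xI : x \in `]0, T[ by rewrite in_itv/=; apply/andP; split; lra.
    by case: (flow_is_derive xI).
  - by rewrite in_itv/= sr.
  - move=> x; rewrite in_itv/= => /andP[sx xt].
    by rewrite /= (cst x) ?(ltW sx) ?(ltW xt)// (cst r) ?(ltW sr) ?(ltW rt).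
have rI : r \in `]0, T[ by rewrite in_itv/=; apply/andP; split; lra.
by case: (flow_is_derive rI) => _; case: d => _ -> /eqP; rewrite eq_sym oppr_eq0 => /eqP.
Qed.

Lemma flow_constant s t : 0 <= s -> s <= t -> t <= T -> f (g s) = f (g t) -> g t = g s.
Proof.
move=> s0; rewrite le_eqVlt => /predU1P[->//|st] tT fst.
apply/eqP; rewrite -subr_eq0; apply/eqP/dotv_eq0.
have dg x : x \in `[0, T] -> derivable_within `[0, T] g x by move=> /flow[].
have [r rst ->] := MVT_within (g t - g s) dg s0 st tT.
have [_ ->] : derivable_within `[0, T] g r /\ derive_within `[0, T] g r = - grad f (g r).
  by apply: flow; rewrite /= in_itv/=; move: rst => /andP[sr rt]; apply/andP; split; lra.
by rewrite (flow_stationary s0 tT fst rst) oppr0 dotv0r mul0r.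
Qed.

End Flow.

(** * Tangents under a homeomorphic change of parameter *)

Section Transfer.
Context {R : realType} {n : nat}.
Context (A B : set R) (g : R -> 'rV[R]_n) (theta : R -> R) (gt : R -> 'rV[R]_n).
Context (thetaB : forall s, A s -> B (theta s)).
Context (theta_mono : forall s s', A s -> A s' -> s < s' -> theta s < theta s').
Context (theta_cont : {within A, continuous theta}).
Context (gtE : forall s, A s -> gt (theta s) = g s).

Lemma reparam_diff_quot t s : A t -> A s -> s != t ->
  diff_quot g t s = ((theta s - theta t) / (s - t)) *: diff_quot gt (theta t) (theta s) /\
  0 <= (theta s - theta t) / (s - t).
Proof.
move=> At As st.
have [p tst] : 0 < (theta s - theta t) / (s - t) /\ theta s != theta t.
  move: st; rewrite neq_lt => /orP[st|ts].
    have h := theta_mono As At st; split; last by rewrite lt_eqF.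
    by rewrite nmulr_rgt0 ?subr_lt0// invr_lt0 subr_lt0.
  have h := theta_mono At As ts; split; last by rewrite gt_eqF.
  by rewrite divr_gt0 ?subr_gt0.
split; last exact: ltW.
rewrite /diff_quot !gtE// scalerA; congr (_ *: _).
by field; rewrite !subr_eq0 tst st.
Qed.

Lemma reparam_cvg t : A t -> theta s @[s --> within A t^'] --> within B (theta t)^'.
Proof.
move=> At P [e /= e0 eP].
have ct : theta @ within A (nbhs t) --> theta t by move/subspace_continuousP : theta_cont; apply.
have H := @cvgr_dist_lt _ _ _ (within A (nbhs t)) _ theta (theta t) ct e e0.
suff : \forall s \near t^', A s -> P (theta s) by [].
have H2 : \forall s \near t^', A s -> `|theta t - theta s| < e.
  by apply: cvg_within; exact: H.
near=> s => As.
have st : s != t by near: s; exact: nbhs_dnbhs_neq.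
apply: eP => /=; last exact: thetaB.
  by move: As; near: s.
move: st; rewrite neq_lt => /orP[st|ts].
  by rewrite lt_eqF// theta_mono.
by rewrite gt_eqF// theta_mono.
Unshelve. all: by end_near. Qed.

(** [theta] may fail to be differentiable, so there is no chain rule. Corresponding difference
    quotients are positive multiples of each other, hence satisfy the homogeneous identity
    [<p, w> |q| = |p| <q, w>], which survives the limit. *)
Lemma reparam_dotv t w : ProperFilter (within A t^') -> A t ->
  derivable_within A g t -> derivable_within B gt (theta t) ->
  dotv (derive_within A g t) w * enorm (derive_within B gt (theta t)) =
  enorm (derive_within A g t) * dotv (derive_within B gt (theta t)) w.
Proof.
move=> PF At dg dgt.
have dq : diff_quot gt (theta t) (theta s) @[s --> within A t^'] --> derive_within B gt (theta t).
  exact: (@cvg_comp _ _ _ theta (diff_quot gt (theta t)) _ (within B (theta t)^')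
    _ (reparam_cvg At) dgt).
have FF := @filter_filter _ _ PF.
have c1 : dotv (diff_quot g t s) w * enorm (diff_quot gt (theta t) (theta s)) @[s --> within A t^']
    --> dotv (derive_within A g t) w * enorm (derive_within B gt (theta t)).
  apply: cvgM; last exact: (enorm_cvg FF dq).
  have d := dotv_cvgr (FF := FF) (u := w) dg.
  by rewrite dotvC; under eq_fun do rewrite dotvC.
have c2 : enorm (diff_quot g t s) * dotv (diff_quot gt (theta t) (theta s)) w @[s --> within A t^']
    --> enorm (derive_within A g t) * dotv (derive_within B gt (theta t)) w.
  apply: cvgM; first exact: (enorm_cvg FF dg).
  have d := dotv_cvgr (FF := FF) (u := w) dq.
  by rewrite dotvC; under eq_fun do rewrite dotvC.
rewrite -(cvg_lim (@norm_hausdorff _ _) c1); apply: cvg_lim; first exact: norm_hausdorff.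
apply: cvg_trans c2; apply: near_eq_cvg.
rewrite near_withinE; near=> s => As.
have st : s != t by near: s; exact: nbhs_dnbhs_neq.
have [-> p] := reparam_diff_quot At As st.
by rewrite enormZ//; move: (diff_quot gt _ _) => q; rewrite dotvZl mulrAC.
Unshelve. all: by end_near. Qed.

End Transfer.

Lemma flow_strongly_self_contracted (R : realType) (n : nat) (L T : R)
    (f : 'rV[R]_n -> R) (g gt : R -> 'rV[R]_n) :
  0 < L -> (forall t, t \in `[0, L] -> derivable_within `[0, L] g t) ->
  arc_length_param `[0, L] g -> parameterization `[0, L] `[0, T] g gt ->
  C1_convex f -> gradient_curve `[0, T] f gt -> strongly_self_contracted `[0, L] g.
Proof.
move=> L0 dg garc [theta [eta [[thE etE thm thc _] gtE]]] fC flow; split=> // t s tL sL ts _.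
have gth r : r \in `[0, L] -> gt (theta r) = g r.
  by move=> rL; have [h1 h2] := thE r rL; rewrite gtE// h2.
have [ta _] := thE t tL; move: (ta); rewrite /= in_itv/= => /andP[a0 aT].
have [bT _] := thE s sL; move: bT; rewrite /= in_itv/= => /andP[b0 bT].
have ab := thm t s tL sL ts.
(* Equal values would make the flow, hence [g], constant between [t] and [s], against unit speed: at
   the midpoint [r], [<g' r, g>] would have derivative both 0 and 1. *)
have decr : f (gt (theta s)) < f (gt (theta t)).
  rewrite lt_neqAle (flow_nincr fC flow)// ?(ltW ab)// andbT; apply/eqP => fE.
  have cst r : t < r < s -> g r = g t.
    move=> /andP[tr rs].
    have rL : r \in `[0, L].
      by move: tL sL; rewrite /= !in_itv/= => /andP[? ?] /andP[? ?]; apply/andP; split; lra.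
    have tr' := thm t r tL rL tr; have rs' := thm r s rL sL rs.
    rewrite -!gth//; apply: (flow_constant fC flow) => //; [exact: ltW|lra|].
    apply/eqP; rewrite eq_le; apply/andP; split.
      by rewrite -fE; apply: (flow_nincr fC flow) => //; lra.
    by apply: (flow_nincr fC flow) => //; lra.
  pose r := (t + s) / 2.
  have r1 : t < r by rewrite /r; lra.
  have r2 : r < s by rewrite /r; lra.
  have rI : r \in `]0, L[.
    by move: tL sL; rewrite /= !in_itv/= => /andP[? ?] /andP[? ?]; apply/andP; split; lra.
  have rI' := subset_itv_oo_cc rI.
  pose u := derive_within `[0, L] g r.
  have d1 := derive_within_dotv u rI (dg r rI').
  have d2 : is_derive r 1 (dotv u \o g) 0.
    apply: (@derive1_at_min _ _ t s); first exact: ltW.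
    - move=> x; rewrite in_itv/= => /andP[tx xs].
      have xI : x \in `]0, L[.
        by move: tL sL; rewrite /= !in_itv/= => /andP[? ?] /andP[? ?]; apply/andP; split; lra.
      by case: (derive_within_dotv u xI (dg x (subset_itv_oo_cc xI))).
    - by rewrite in_itv/= r1.
    - by move=> x; rewrite in_itv/= => xI; rewrite /= !cst ?r1.
  case: d1 => _; case: d2 => _ -> /eqP.
  by rewrite (enorm_eq1 (garc r rI')) eq_sym oner_eq0.
have [dgt dgtE] := flow _ ta.
have PF : ProperFilter (within `[0, L] t^').
  exact: (within_dnbhs_proper L0 (@subset_refl _ _) tL).
have := reparam_dotv (fun r rL => (thE r rL).1) thm thc gth (g s - g t) PF tL (dg t tL) dgt.
rewrite (garc t tL) mul1r dgtE dotvNl => E.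
have sg := C1_convex_subgradient fC (gt (theta t)) (gt (theta s)).
(* By [E] the product is [<- grad f, g s - g t>], at least the decrease of [f]. Since the norm is
   nonnegative, the other factor must be positive. *)
have p : 0 < dotv (derive_within `[0, L] g t) (g s - g t) * enorm (- grad f (gt (theta t))).
  by rewrite E -!gth//; lra.
rewrite ltNge; apply/negP => h.
have := mulr_le0_ge0 h (sqrtr_ge0 _ : 0 <= enorm (- grad f (gt (theta t)))).
by rewrite leNgt p.
Qed.

(** * The equivalence *)

(** [D] is kept apart from [A]: for infinite time the curve runs over [[0, L[], while its derivative
    is taken in [[0, L]]. *)
Lemma gradient_curve_reparam (R : realType) (n : nat) (A B D : set R)
    (f : 'rV[R]_n -> R) (g : R -> 'rV[R]_n) (theta eta h : R -> R) :
  A `<=` D -> increasing_homeo A B theta eta ->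
  (forall t, D t -> derivable_within D g t) ->
  (forall t, B t -> ProperFilter (within B t^')) ->
  (forall t, B t -> is_derive t 1 eta (h (eta t))) ->
  (forall s, D s -> grad f (g s) = - (h s *: derive_within D g s)) ->
  gradient_curve B f (g \o eta).
Proof.
move=> AD [_ etaA _ _ _] dg PB deta gradf t Bt.
have etaD s : B s -> D (eta s) by move=> /etaA[/AD].
have inj s : B s -> s != t -> eta s != eta t.
  move=> Bs; apply: contra => /eqP E; apply/eqP.
  by have [_ <-] := etaA s Bs; rewrite E; case: (etaA t Bt).
have := reparam_derive_within etaD inj (deta t Bt) (PB t Bt) Bt (dg _ (etaD _ Bt)).
by rewrite /= gradf ?opprK//; exact: etaD.
Qed.

Lemma C1_convex_grad0_min (R : realType) (n : nat) (f : 'rV[R]_n -> R) x :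
  C1_convex f -> grad f x = 0 -> forall y, f x <= f y.
Proof.
by move=> fC fx y; have := C1_convex_subgradient fC x y; rewrite fx dotv0l addr0.
Qed.

Lemma self_contracted_potential (R : realType) (n : nat) (L alpha : R)
    (g : R -> 'rV[R]_n) : 0 < L -> 2^-1 <= alpha ->
  C1_hoelder_on `[0, L] alpha g -> arc_length_param `[0, L] g ->
  strongly_self_contracted `[0, L] g ->
  exists2 k, 0 < k & forall c, 0 <= c <= 1 ->
    exists2 f : 'rV[R]_n -> R, C1_convex f &
      forall t, `[0, L]%classic t -> grad f (g t) =
        - ((expR (k * (L - t)) - c) *: derive_within `[0, L] g t).
Proof.
move=> L0 ha [[dg cg'] hg] garc [_ ssc].
have [C C0 hC] := hoelder_sqr (ltW L0) ha hg.
apply: (@exists_potential R n L C g (derive_within `[0, L] g)) => //.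
- by move=> u s t; exact: (MVT_within u dg).
- exact: derivable_within_subspace dg.
- by move=> t tL; exact/enorm_eq1/garc.
- move=> t s tL sL ts; apply: ssc => // g0.
  have := enorm_eq1 (garc t tL); rewrite g0 dotv0l => /eqP.
  by rewrite eq_sym oner_eq0.
- exact: ltW.
Qed.

Theorem theorem1p2 (R : realType) (n : nat) (L alpha : R)
    (gamma : R -> 'rV[R]_n) (hL : 0 < L) (halpha : 2^-1 < alpha <= 1)
    (hC1a : C1_hoelder_on `[0, L] alpha gamma)
    (harc : arc_length_param `[0, L] gamma) :
  (strongly_self_contracted `[0, L] gamma <->
   exists (T : R) (gammat : R -> 'rV[R]_n) (f : 'rV[R]_n -> R),
     [/\ parameterization `[0, L] `[0, T] gamma gammat,
         C1_convex f & gradient_curve `[0, T] f gammat]) /\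
  (strongly_self_contracted `[0, L] gamma -> Ck_on `[0, L] 3 gamma ->
   exists (f : 'rV[R]_n -> R) (gammat : R -> 'rV[R]_n),
     [/\ C1_convex f,
         forall x, f (gamma L) <= f x,
         parameterization `[0, L[ `[0, +oo[ gamma gammat,
         gammat t @[t --> +oo] --> gamma L &
         gradient_curve `[0, +oo[ f gammat]).
Proof.
have [[dg _] _] := hC1a.
have /andP[/ltW ha _] := halpha.
split; first split.
- move=> ssc.
  (* With [c = 0] the speed is at least 1 on the whole interval, so [L] is reached in finite
     time. *)
  have [k k0 /(_ 0)[|f fC gradf]] := self_contracted_potential hL ha hC1a harc ssc.
    by rewrite lexx ler01.
  have H := fin_homeo L k0.
  exists (fin_time k L L), (gamma \o log_pos k L (fin_weight k L)), f; split=> //.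
    by exists (fin_time k L), (log_pos k L (fin_weight k L)); split.
  apply: (gradient_curve_reparam _ H dg _ _ gradf) => // t.
    apply: within_dnbhs_proper; last exact: subset_refl.
    by rewrite -(fin_time0 k L); exact: fin_time_lt.
  rewrite /= in_itv/= => /andP[t0 _].
  by apply: is_derive_log_pos => //; [exact: fin_weight_gt0|exact: is_derive_fin_weight].
- move=> [T [gt [f [par fC flow]]]].
  exact: flow_strongly_self_contracted hL dg harc par fC flow.
- move=> ssc _.
  (* With [c = 1] the gradient vanishes at [gamma L], which is therefore a minimum point. *)
  have [k k0 /(_ 1)[|f fC gradf]] := self_contracted_potential hL ha hC1a harc ssc.
    by rewrite lexx ler01.
  have H := inf_homeo k0 hL.
  have LL : `[0, L]%classic L by rewrite /= in_itv/= lexx ltW.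
  exists f, (gamma \o log_pos k L (inf_weight k L)); split=> //.
  + apply: C1_convex_grad0_min => //.
    by rewrite gradf// subrr mulr0 expR0 subrr scale0r oppr0.
  + by exists (inf_time k L), (log_pos k L (inf_weight k L)); split.
  (* [gamma] is continuous at [L] only along [[0, L]], so the positions must be shown to stay in
     that interval. *)
  + apply: (@cvg_comp _ _ _ (log_pos k L (inf_weight k L)) gamma
      _ (within `[0, L] (nbhs L))); last first.
      exact: derivable_within_cvg LL (dg L LL).
    move=> P /(inf_pos_cvg (L := L) k0) /= PL.
    have [_ inA _ _ _] := H.
    suff : \forall t \near +oo, P (log_pos k L (inf_weight k L) t) by [].
    near=> t.
    have /inA[] : `[0, +oo[%classic t.
      by rewrite /= in_itv/= andbT; near: t; exact: nbhs_pinfty_ge.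
    rewrite /= in_itv/= => /andP[p0 /ltW p1] _.
    have : `[0, L]%classic (log_pos k L (inf_weight k L) t).
      by rewrite /= in_itv/= p0.
    by near: t.
  + apply: (gradient_curve_reparam _ H dg _ _ gradf).
    * by move=> s /=; rewrite !in_itv/= => /andP[-> /ltW].
    * move=> t; rewrite /= in_itv/= andbT => t0.
      apply: (@within_dnbhs_proper _ _ 0 (t + 1)); first by lra.
        by move=> s /=; rewrite !in_itv/= => /andP[->].
      by rewrite in_itv/= t0 lerDl ler01.
    * move=> t; rewrite /= in_itv/= andbT => t0.
      have /andP[w0 _] := inf_weight_bounds k0 hL t0.
      exact: is_derive_log_pos w0 (is_derive_inf_weight k L t).
Unshelve. all: by end_near. Qed.
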